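(* Let $q\in L^{1}[0,1]$ be real-valued, let $t\in[0,2\pi)$ be fixed, and let $\lambda_{0}(t)$ be the first (smallest) eigenvalue of the quasi-periodic boundary value problem $L_{t}(q)$. Then: (a) If $t\in[0,\pi)$ and $\lambda_{0}(t)\geq t^{2}+\int_{0}^{1}q(x)\,dx$, then $q=\int_{0}^{1}q(x)\,dx$ almost everywhere on $[0,1]$. (b) If $t\in[\pi,2\pi)$ and $\lambda_{0}(t)\geq (2\pi-t)^{2}+\int_{0}^{1}q(x)\,dx$, then $q=\int_{0}^{1}q(x)\,dx$ almost everywhere on $[0,1]$.
   Context: For a real-valued function $q\in L^{1}[0,1]$ and $t\in[0,2\pi)$, $L_{t}(q)$ denotes the self-adjoint operator in $L^{2}[0,1]$ (equivalently, the boundary value problem) generated by the differential equation $$-y''(x)+q(x)y(x)=\lambda y(x),\qquad x\in[0,1],$$ and the quasi-periodic boundary conditions $$y(1)=e^{it}y(0),\qquad y'(1)=e^{it}y'(0).$$ The cases $t=0$ and $t=\pi$ are the periodic and anti-periodic problems, respectively. The first eigenvalue $\lambda_{0}(t)$ is the smallest eigenvalue of $L_t(q)$. *)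

(* Defs.v *)
From HB Require Import structures.
From mathcomp Require Import all_boot all_order all_algebra.
From mathcomp Require Import complex.
From mathcomp Require Import all_classical all_reals all_analysis.

Set Implicit Arguments.
Unset Strict Implicit.
Unset Printing Implicit Defensive.

Import Order.TTheory GRing.Theory Num.Theory.
Import numFieldNormedType.Exports.

Local Open Scope classical_set_scope.
Local Open Scope complex_scope.
Local Open Scope ring_scope.

(* f'(x) = l for f restricted to D: the limit runs over z <> x in D, hence the
   derivative is one-sided at the endpoints when D is a closed interval. *)
Definition has_derivative_within (R : realType) (D : set R) (f : R -> R)
    (x l : R) : Prop :=
  (f z - f x) / (z - x) @[z --> within D x^'] --> l.

Definition has_cderivative_within (R : realType) (D : set R) (y : R -> R[i])
    (x : R) (l : R[i]) : Prop :=
  has_derivative_within D (fun z => complex.Re (y z)) x (complex.Re l) /\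
  has_derivative_within D (fun z => complex.Im (y z)) x (complex.Im l).

(* The epsilon-delta definition; the degenerate intervals that are allowed
   here contribute nothing to either sum. *)
Definition absolutely_continuous_on (R : realType) (a b : R) (f : R -> R)
    : Prop :=
  forall e : R, 0 < e -> exists2 d : R, 0 < d &
    forall (n : nat) (l r : 'I_n -> R),
      (forall i, a <= l i /\ l i <= r i /\ r i <= b) ->
      trivIset [set: 'I_n] (fun i => `](l i), (r i)[%classic) ->
      \sum_(i < n) (r i - l i) < d ->
      \sum_(i < n) `|f (r i) - f (l i)| < e.

Definition cabsolutely_continuous_on (R : realType) (a b : R)
    (y : R -> R[i]) : Prop :=
  absolutely_continuous_on a b (fun x => complex.Re (y x)) /\
  absolutely_continuous_on a b (fun x => complex.Im (y x)).

Definition expi (R : realType) (t : R) : R[i] := cos t +i* sin t.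

(* y is a solution, with derivative y', of - y'' + q y = lambda y on [0, 1]:
   y and y' are absolutely continuous and the equation holds almost
   everywhere (y'' exists only almost everywhere, since q is merely L^1). *)
Definition is_solution (R : realType) (q : R -> R) (lambda : R)
    (y y' : R -> R[i]) : Prop :=
  [/\ cabsolutely_continuous_on 0 1 y,
      cabsolutely_continuous_on 0 1 y',
      forall x : R, `[0, 1]%classic x ->
        has_cderivative_within `[0, 1] y x (y' x) &
      {ae (@lebesgue_measure R), forall x : R, `[0, 1]%classic x ->
        exists2 y'' : R[i], has_cderivative_within `[0, 1] y' x y'' &
          - y'' + (q x)%:C * y x = lambda%:C * y x}].

Definition quasi_periodic (R : realType) (t : R) (y y' : R -> R[i]) : Prop :=
  y 1 = expi t * y 0 /\ y' 1 = expi t * y' 0.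

(* L_t(q) is self-adjoint, so that its eigenvalues are real numbers; the
   eigenfunctions are complex-valued. *)
Definition is_eigenvalue (R : realType) (q : R -> R) (t lambda : R) : Prop :=
  exists y y' : R -> R[i],
    [/\ is_solution q lambda y y', quasi_periodic t y y' &
        exists2 x : R, `[0, 1]%classic x & y x != 0].

Definition is_first_eigenvalue (R : realType) (q : R -> R) (t lambda0 : R)
    : Prop :=
  is_eigenvalue q t lambda0 /\
  forall mu : R, is_eigenvalue q t mu -> lambda0 <= mu.

(* Main.v *)
Require Import Defs.
From HB Require Import structures.
From mathcomp Require Import all_boot all_order all_algebra.
From mathcomp Require Import complex.
From mathcomp Require Import all_classical all_reals all_analysis.
From mathcomp Require Import ring lra.

(** Let m be the mean of q over [0, 1], and let F be the primitive of q - m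
    whose mean over [0, 1] is 0.  Then F 0 = F 1, and the primitive G of F
    that vanishes at 0 vanishes at 1 as well.  Write lambda = nu + m.
    Integrating q - m by parts, the quadratic form of L_t(q) - lambda at a
    quasi-periodic phi is the integral of
    [|phi' - F phi|^2 - (nu + F^2) |phi|^2].
    At phi x = e^(G x + i tau x), where cos tau = cos t, this is the integral
    of e^(2 G) (tau^2 - nu - F^2).  If it is nonnegative for every nu below
    lambda0 - m, and if tau^2 + m <= lambda0, then letting nu tend to
    lambda0 - m shows that the integral of e^(2 G) F^2 is at most 0: hence
    F = 0 and q = m almost everywhere ([primitive_eq0_of_energy],
    [rigidity_of_plane_wave]).  The two halves of the theorem are the choices
    tau = t and tau = 2 pi - t.

    What has to be shown is that the form is nonnegative when there is no
    eigenvalue below lambda0.  The substitution y = e^G v,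
    y' = F y + e^(- G) w turns the equation into the system
    v' = e^(- 2 G) w, w' = - (nu + F^2) e^(2 G) v, whose coefficients are
    continuous; the integrable function q only enters when its solutions are
    turned back into solutions of the given equation ([lift]).  Let (c, C)
    and (s, S) be the solutions of the system that start from (1, 0) and from
    (0, 1), obtained by Picard iteration.

    - If D nu = c 1 + S 1 equals 2 cos t, then nu + m is an eigenvalue
      ([discriminant_eigenvalue]).  D is continuous, and D >= 2 for very
      negative nu, so D > 2 cos t at every nu below lambda0 - m
      ([discriminant_gt]).
    - For these nu, s does not vanish on ]0, 1].  Otherwise, at the least nu
      where it does, the zero lies at 1 and S 1 < 0; as c 1 * S 1 = 1, this
      gives D <= - 2 <= 2 cos t ([positive_of_discriminant]).
    - Once s is positive, Picone's identity bounds the form at phi below by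
      |phi 0|^2 (D nu - 2 cos t) / s 1 ([picone_lower_bound],
      [plane_wave_energy]). *)

Set Implicit Arguments.
Unset Strict Implicit.
Unset Printing Implicit Defensive.

Import Order.TTheory GRing.Theory Num.Theory.
Import numFieldNormedType.Exports.

Local Open Scope classical_set_scope.
Local Open Scope ring_scope.

(** * Differential calculus on the line *)

Lemma is_derive_continuous (R : realType) (f : R -> R) (x d : R) :
  is_derive x 1 f d -> {for x, continuous f}.
Proof. by move=> [fx _]; exact/differentiable_continuous/derivable1_diffP. Qed.

Lemma is_derive_continuousT (R : realType) (f df : R -> R) :
  (forall x : R, is_derive x 1 f (df x)) -> continuous f.
Proof. by move=> h x; exact: is_derive_continuous. Qed.

Lemma is_derive_within_continuous (R : realType) (f df : R -> R) (A : set R) :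
  (forall x, A x -> is_derive x 1 f (df x)) -> {within A, continuous f}.
Proof.
move=> h; apply: continuous_in_subspaceT => x /set_mem /h.
exact: is_derive_continuous.
Qed.

Lemma mean_value (R : realType) (f df : R -> R) (a b : R) : a <= b ->
  (forall x, a <= x <= b -> is_derive x 1 f (df x)) ->
  exists2 c, a <= c <= b & f b - f a = df c * (b - a).
Proof.
move=> ab h; have [||c cab ->] := @MVT_segment R f df a b ab.
- by move=> x; rewrite in_itv/= => /andP[ax xb]; apply: h; rewrite !ltW.
- apply: (@is_derive_within_continuous _ _ df) => x /=; rewrite in_itv/=; exact: h.
- by exists c => //; rewrite in_itv/= in cab.
Qed.

Lemma derive_ge0_le (R : realType) (f df : R -> R) (a b : R) : a <= b ->
  (forall x, a <= x <= b -> is_derive x 1 f (df x)) ->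
  (forall x, a <= x <= b -> 0 <= df x) -> f a <= f b.
Proof.
move=> ab h d0; have [c cab e] := mean_value ab h.
by rewrite -subr_ge0 e mulr_ge0 ?d0// subr_ge0.
Qed.

Lemma derive_le (R : realType) (f g df dg : R -> R) (a b : R) : a <= b ->
  (forall x, a <= x <= b -> is_derive x 1 f (df x)) ->
  (forall x, a <= x <= b -> is_derive x 1 g (dg x)) ->
  (forall x, a <= x <= b -> df x <= dg x) -> f b - f a <= g b - g a.
Proof.
move=> ab hf hg d0.
have := @derive_ge0_le _ (g \- f) (dg \- df) _ _ ab.
have h x : a <= x <= b -> is_derive x 1 (g \- f) ((dg \- df) x).
  by move=> axb; apply: is_deriveB; [exact: hg|exact: hf].
move=> /(_ h) /=; have h1 x : a <= x <= b -> 0 <= dg x - df x.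
  by move=> ?; rewrite subr_ge0 d0.
move=> /(_ h1); lra.
Qed.

Lemma derive_bound_lipschitz (R : realType) (f df : R -> R) (a b M : R) :
  (forall x, a <= x <= b -> is_derive x 1 f (df x)) ->
  (forall x, a <= x <= b -> `|df x| <= M) ->
  forall x y, a <= x <= b -> a <= y <= b -> `|f x - f y| <= M * `|x - y|.
Proof.
move=> hf hM; have main x y : a <= x <= b -> a <= y <= b -> x <= y ->
    `|f x - f y| <= M * `|x - y|.
  move=> /andP[ax xb] /andP[ay yb] xy.
  have h z : x <= z <= y -> is_derive z 1 f (df z).
    by move=> /andP[xz zy]; apply: hf; rewrite (le_trans ax xz) (le_trans zy yb).
  have [c /andP[xc cy] e] := mean_value xy h.
  rewrite distrC e normrM (distrC x y) ler_wpM2r//.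
  by apply: hM; rewrite (le_trans ax xc) (le_trans cy yb).
move=> x y hx hy; have [xy|/ltW yx] := leP x y; first exact: main.
by rewrite distrC (distrC x y); exact: main.
Qed.

Lemma is_derive_epsP (R : realType) (f : R -> R) (x d : R) :
  (forall e, 0 < e -> \forall y \near x,
     `|f y - f x - d * (y - x)| <= e * `|y - x|) -> is_derive x 1 f d.
Proof.
move=> h; apply/is_derive1_caratheodory.
exists (fun y => if y == x then d else (f y - f x) / (y - x)); split.
- move=> z; case: eqP => [->|/eqP]; first by rewrite !subrr mulr0.
  by rewrite -subr_eq0 => /divfK ->.
- apply/cvgrPdist_le => e e0; near=> y; rewrite eqxx.
  case: eqP => [_|/eqP yx]; first by rewrite subrr normr0 ltW.
  have yx0 : y - x != 0 by rewrite subr_eq0.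
  rewrite distrC -(ler_pM2r (_ : 0 < `|y - x|)) ?normr_gt0//.
  by rewrite -normrM mulrBl divfK//; near: y; exact: h.
- by rewrite eqxx.
Unshelve. all: by end_near. Qed.

Lemma is_derive_eps (R : realType) (f : R -> R) (x d : R) :
  is_derive x 1 f d -> forall e, 0 < e -> \forall y \near x,
     `|f y - f x - d * (y - x)| <= e * `|y - x|.
Proof.
move=> /is_derive1_caratheodory[g [fg cg gd]] e e0.
move/cvgrPdist_le : cg => /(_ e e0); apply: filterS => y.
by rewrite fg -mulrBl normrM gd distrC => h; rewrite ler_wpM2r.
Qed.

Lemma near_dist (R : realType) (x d : R) : 0 < d ->
  \forall y \near x, `|y - x| < d.
Proof. by move=> d0; near=> y; rewrite distrC; near: y; exact: nbhsx_ballx.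
Unshelve. all: by end_near. Qed.

(** At a zero, a nonzero slope makes a function negative on one side; on
    ]0, 1[ both sides lie in [0, 1], at 1 only the left one does. *)
Lemma derive_at_zero_of_nonneg (R : realType) (f : R -> R) (d x : R) :
  is_derive x 1 f d -> f x = 0 -> 0 < x <= 1 ->
  (forall y, 0 <= y <= 1 -> 0 <= f y) -> d <= 0 /\ (x < 1 -> d = 0).
Proof.
move=> df fx /andP[x0 x1] f0.
have near_sgn : d != 0 -> exists2 e, 0 < e & forall y, `|y - x| < e ->
    f y <= d * (y - x) + `|d| / 2 * `|y - x|.
  move=> dn0; have d2 : 0 < `|d| / 2 by rewrite divr_gt0// normr_gt0.
  have [e /= e0 he] := is_derive_eps df d2.
  exists e => // y ye; have : ball x e y by rewrite /ball/= distrC.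
  by move=> /he; rewrite fx subr0 ler_norml => /andP[_]; lra.
have d0 : d <= 0.
  rewrite leNgt; apply/negP => dp; have [|e e0 he] := near_sgn; first by rewrite gt_eqF.
  pose h := Num.min (e / 2) x.
  have h0 : 0 < h by rewrite lt_min x0 divr_gt0.
  have [he2 hx] : h <= e / 2 /\ h <= x by rewrite /h !ge_min !lexx orbT.
  have e2 : x - h - x = - h by ring.
  have := he (x - h); rewrite e2 normrN (gtr0_norm h0) (gtr0_norm dp).
  have := f0 (x - h); have -> : 0 <= x - h <= 1 by apply/andP; split; lra.
  move=> /(_ isT) H /(_ _); have hlte : h < e by lra.
  by move=> /(_ hlte); have := mulr_gt0 dp h0; lra.
split => // x_lt1; apply/eqP; rewrite eq_le d0/= leNgt; apply/negP => dn.
have [|e e0 he] := near_sgn; first by rewrite lt_eqF.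
pose h := Num.min (e / 2) (1 - x).
have h0 : 0 < h by rewrite lt_min subr_gt0 x_lt1 divr_gt0.
have [he2 hx] : h <= e / 2 /\ h <= 1 - x by rewrite /h !ge_min !lexx orbT.
have e2 : x + h - x = h by ring.
have := he (x + h); rewrite e2 (gtr0_norm h0) (ltr0_norm dn).
have := f0 (x + h); have -> : 0 <= x + h <= 1 by apply/andP; split; lra.
move=> /(_ isT) H /(_ _); have hlte : h < e by lra.
by move=> /(_ hlte); have := mulr_gt0 h0 (_ : 0 < - d); rewrite oppr_gt0 => /(_ dn); lra.
Qed.

(** The rules of differentiation for functions given as abstractions, with
    products in place of scalings, so that the derivatives they produce are
    ring expressions. *)
Section PointwiseRules.
Context {R : realType}.
Implicit Types (f g : R -> R) (x k df dg : R).

Lemma is_derive_add f g x df dg : is_derive x 1 f df -> is_derive x 1 g dg ->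
  is_derive x 1 (fun y => f y + g y) (df + dg).
Proof. by move=> hf hg; exact: is_deriveD. Qed.

Lemma is_derive_sub f g x df dg : is_derive x 1 f df -> is_derive x 1 g dg ->
  is_derive x 1 (fun y => f y - g y) (df - dg).
Proof. by move=> hf hg; exact: is_deriveB. Qed.

Lemma is_derive_opp f x df : is_derive x 1 f df -> is_derive x 1 (fun y => - f y) (- df).
Proof. by move=> hf; exact: is_deriveN. Qed.

Lemma is_derive_mul f g x df dg : is_derive x 1 f df -> is_derive x 1 g dg ->
  is_derive x 1 (fun y => f y * g y) (df * g x + f x * dg).
Proof.
move=> hf hg; have := is_deriveM hf hg.
by rewrite /GRing.scale/= addrC (mulrC (g x)).
Qed.

Lemma is_derive_scale k f x df : is_derive x 1 f df ->
  is_derive x 1 (fun y => k * f y) (k * df).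
Proof. by move=> hf; exact: is_deriveZ. Qed.

Lemma is_derive_expR_comp f x df : is_derive x 1 f df ->
  is_derive x 1 (fun y => expR (f y)) (expR (f x) * df).
Proof. by move=> hf; apply: (is_derive1_comp (f := expR)). Qed.

End PointwiseRules.

Lemma continuous_integrable_itv (R : realType) (f : R -> R) (a b : R) :
  continuous f ->
  (@lebesgue_measure R).-integrable `[a, b] (EFin \o f).
Proof.
move=> cf; apply: continuous_compact_integrable; first exact: segment_compact.
exact: continuous_subspaceT.
Qed.

(** The integral from a base point - N has the right derivative only to the
    right of - N.  Subtracting its value at 0 makes the result independent of
    N, so that N may be chosen near each point. *)
Lemma antiderivative (R : realType) (f : R -> R) : continuous f ->
  exists2 P : R -> R, P 0 = 0 & forall x : R, is_derive x 1 P (f x).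
Proof.
move=> cf.
pose A (N x : R) := \int[@lebesgue_measure R]_(t in `[- N, x]) f t.
pose P (x : R) : R := A (`|x| + 1) x - A (`|x| + 1) 0.
have AE (N N' x : R) : N <= N' -> - N <= x -> A N' x - A N' (- N) =
    \int[@lebesgue_measure R]_(t in `]- N, x]) f t.
  move=> NN Nx; apply: Rintegral_itvB; rewrite ?bnd_simp ?lerN2//.
  exact: continuous_integrable_itv.
have AB (N N' x : R) : 0 <= N -> N <= N' -> - N <= x ->
    A N' x - A N' 0 = A N x - A N 0.
  move=> N0 NN Nx; have N0' : - N <= 0 by rewrite oppr_le0.
  have := AE _ _ _ NN Nx; have := AE _ _ _ NN N0'.
  have := AE _ _ _ (lexx N) Nx; have := AE _ _ _ (lexx N) N0'.
  lra.
exists P; first by rewrite /P subrr.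
move=> x; pose N : R := `|x| + 2.
have [|||| dA A'] := @continuous_FTC1 R f (BLeft (- N)) x (x + 1) _ _ _ _.
- by rewrite ltrDl.
- exact: continuous_integrable_itv.
- rewrite lte_fin /N; have := ler_norm (- x); rewrite normrN; lra.
- exact: cf.
have {}dA : is_derive x 1 (A N) (f x).
  by rewrite -A' derive1E; exact: derivableP.
apply: (@near_eq_is_derive _ _ _ (fun y => A N y - A N 0)); last first.
  by rewrite -[f x]subr0; exact: is_deriveB.
near=> y; rewrite /P; apply: AB; first by rewrite addr_ge0.
  rewrite /N.
  have : `|y - x| < 1 by near: y; exact: near_dist.
  by have := ler_normD (y - x) x; rewrite subrK; lra.
by have := ler_norm (- y); rewrite normrN; lra.
Unshelve. all: by end_near. Qed.

(** * Picard iteration for linear systems *)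

Lemma is_derive_expn_fact (R : realType) (n : nat) (x : R) :
  is_derive x 1 (fun y : R => y ^+ n.+1 / n.+1`!%:R) (x ^+ n / n`!%:R).
Proof.
elim: n x => [|n IH] x.
  have -> : (fun y : R => y ^+ 1 / 1`!%:R) = id.
    by apply/funext => y; rewrite expr1 divr1.
  by rewrite expr0 divr1; exact: is_derive_id.
have -> : (fun y : R => y ^+ n.+2 / n.+2`!%:R) =
    (fun y => (n.+2%:R)^-1 * (y * (y ^+ n.+1 / n.+1`!%:R))).
  by apply/funext => y; rewrite (exprS y n.+1) factS natrM invfM; ring.
apply: (is_derive_eq (is_derive_scale _ (is_derive_mul (is_derive_id x (1 : R)) (IH x)))).
rewrite mul1r (exprS x n) factS natrM invfM -[n.+2]addn1 natrD.
have h2 : n`!%:R != 0 :> R by rewrite pnatr_eq0 -lt0n fact_gt0.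
by field; rewrite h2 nat1r natr1 !pnatr_eq0.
Qed.

(** The induction step behind the factorial decay of Picard iterates. *)
Lemma antiderivative_bound (R : realType) (P f : R -> R) (K : R) (n : nat) :
  P 0 = 0 -> (forall x : R, is_derive x 1 P (f x)) ->
  (forall x, `|f x| <= K * (`|x| ^+ n / n`!%:R)) ->
  forall x, `|P x| <= K * (`|x| ^+ n.+1 / n.+1`!%:R).
Proof.
have main (Q g : R -> R) (x : R) : Q 0 = 0 ->
    (forall x : R, is_derive x 1 Q (g x)) ->
    (forall x, `|g x| <= K * (`|x| ^+ n / n`!%:R)) -> 0 <= x ->
    `|Q x| <= K * (x ^+ n.+1 / n.+1`!%:R).
  move=> Q0 dQ bg x0.
  pose e (y : R) := K * (y ^+ n.+1 / n.+1`!%:R).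
  have de y : 0 <= y <= x -> is_derive y 1 e (K * (y ^+ n / n`!%:R)).
    by move=> _; apply: is_derive_scale; exact: is_derive_expn_fact.
  have e0 : e 0 = 0 by rewrite /e expr0n/= mul0r mulr0.
  rewrite ler_norml; apply/andP; split.
    have dNe y : 0 <= y <= x -> is_derive y 1 (\- e) (- (K * (y ^+ n / n`!%:R))).
      by move=> hy; apply: is_deriveN; exact: de.
    have := @derive_le _ (\- e) Q _ g _ _ x0 dNe (fun y _ => dQ y).
    rewrite Q0 /= e0 oppr0 !subr0 addr0; apply => y /andP[y0 yx].
    by have := bg y; rewrite (ger0_norm y0) ler_norml => /andP[].
  have := @derive_le _ Q e g _ _ _ x0 (fun y _ => dQ y) de.
  rewrite Q0 e0 !subr0; apply => y /andP[y0 yx].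
  by have := bg y; rewrite (ger0_norm y0) ler_norml => /andP[].
move=> P0 dP bf x; have [x0|/ltW x0] := leP 0 x.
  by rewrite (ger0_norm x0); exact: (main P f).
have -> : P x = (P \o -%R) (- x) by rewrite /= opprK.
rewrite (ler0_norm x0); apply: (main (P \o -%R) (fun y => f (- y) * -1)).
- by rewrite /= oppr0.
- by move=> y; rewrite mulrN1 normrN -(normrN y); exact: bf.
- by rewrite oppr_ge0.
Qed.

(** Meant for the partial sums S and T of Picard iterates.  Each difference
    quotient of S is a value of a * T at an intermediate point, and this is
    close to a x * T n x uniformly in n because the T n are locally
    bounded and Lipschitz with constants independent of n; so
    the limit in n can be taken before the limit of the quotient. *)
Lemma is_derive_limit (R : realType) (a v w : R -> R) (S T : nat -> R -> R)
    (M : R) (B : R -> R) :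
  continuous a -> (forall x, `|a x| <= M) ->
  (forall n (x : R), is_derive x 1 (S n.+1) (a x * T n x)) ->
  (forall n (x r : R), `|x| <= r -> `|T n x| <= B r) ->
  (forall r : R, exists L, forall n x y, `|x| <= r -> `|y| <= r ->
     `|T n x - T n y| <= L * `|x - y|) ->
  (forall x, S n x @[n --> \oo] --> v x) ->
  (forall x, T n x @[n --> \oo] --> w x) ->
  forall x : R, is_derive x 1 v (a x * w x).
Proof.
move=> ca aM dS TB TL Sv Tw x; apply: is_derive_epsP => e e0.
pose r := `|x| + 1; have [L hL] := TL r.
have B0 : 0 <= B r.
  by apply: le_trans (TB 0%N x r _); rewrite // /r lerDl.
have M0 : 0 <= M by apply: le_trans (aM x).
(* Half of e pays for the variation of a, the other half for that of T n;
   adding 1 to the denominators covers B r = 0 and L = 0. *)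
pose e1 := e / 2 / (B r + 1).
have e10 : 0 < e1 by rewrite !divr_gt0// ltr_wpDl.
pose d := e / 2 / (M * `|L| + 1).
have ML0 : 0 <= M * `|L| by rewrite mulr_ge0.
have d0 : 0 < d by rewrite !divr_gt0// ltr_wpDl.
have [k /= k0 hk] : exists2 k : R, 0 < k &
    forall y, `|y - x| < k -> `|a y - a x| <= e1.
  have /cvgrPdist_le/(_ _ e10)[k /= k0 hk] := ca x.
  by exists k => // y yk; rewrite distrC; apply: hk; rewrite /= distrC.
near=> y.
have yx1 : `|y - x| < 1 by near: y; exact: near_dist.
have yxd : `|y - x| < d by near: y; exact: near_dist.
have yxk : `|y - x| < k by near: y; exact: near_dist.
have key n : `|S n.+1 y - S n.+1 x - a x * T n x * (y - x)| <= e * `|y - x|.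
  have [c hc ec] : exists2 c, `|c - x| <= `|y - x| &
      S n.+1 y - S n.+1 x = a c * T n c * (y - x).
    have [xy|/ltW yx] := leP x y.
      have [c /andP[xc cy] ec] := mean_value xy (fun z _ => dS n z).
      by exists c => //; rewrite !ger0_norm ?subr_ge0//; lra.
    have [c /andP[xc cy] ec] := mean_value yx (fun z _ => dS n z).
    exists c; first by rewrite !ler0_norm ?subr_le0//; lra.
    by apply/eqP; rewrite -eqr_opp opprB ec -mulrN opprB.
  rewrite ec -mulrBl normrM ler_wpM2r//.
  have cr : `|c| <= r.
    by rewrite /r; have := ler_normD (c - x) x; rewrite subrK; lra.
  have xr : `|x| <= r by rewrite /r lerDl.
  have -> : a c * T n c - a x * T n x =
    (a c - a x) * T n c + a x * (T n c - T n x) by ring.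
  apply: (le_trans (ler_normD _ _)); rewrite !normrM.
  have h1 : `|a c - a x| * `|T n c| <= e / 2.
    apply: (@le_trans _ _ (e1 * (B r + 1))).
      apply: ler_pM => //; first by apply: hk; lra.
      by have := TB n _ _ cr; lra.
    by rewrite /e1 divfK// gt_eqF// ltr_wpDl.
  have h2 : `|a x| * `|T n c - T n x| <= e / 2.
    apply: (@le_trans _ _ (M * (`|L| * d))).
      apply: ler_pM => //; apply: le_trans (hL n c x cr xr) _.
      apply: (@le_trans _ _ (`|L| * `|c - x|)).
        by rewrite ler_wpM2r// ler_norm.
      by rewrite ler_wpM2l//; lra.
    rewrite mulrA /d mulrA ler_pdivrMr ?ltr_wpDl// mulrC ler_wpM2l ?lerDl//.
    by rewrite divr_ge0// ltW.
  lra.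
have Sv' z : S n.+1 z @[n --> \oo] --> v z.
  by have := Sv z; rewrite -(cvg_shiftS (S ^~ z)).
have : `|S n.+1 y - S n.+1 x - a x * T n x * (y - x)| @[n --> \oo] -->
    `|v y - v x - a x * w x * (y - x)|.
  apply: cvg_norm; apply: cvgB; first exact: cvgB.
  by apply: cvgM; [apply: cvgM; [exact: cvg_cst|exact: Tw]|exact: cvg_cst].
move=> h; rewrite -(cvg_lim _ h)//; apply: limr_le;
  first by apply/cvg_ex; eexists; exact: h.
by near=> n; exact: key.
Unshelve. all: by end_near. Qed.

Definition solves (R : realType) (a b v w : R -> R) : Prop :=
  forall x : R, is_derive x 1 v (a x * w x) /\ is_derive x 1 w (b x * v x).

Lemma solves_continuous (R : realType) (a b v w : R -> R) : solves a b v w ->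
  continuous v /\ continuous w.
Proof.
move=> h; split.
- by apply: is_derive_continuousT => x; exact: (h x).1.
- by apply: is_derive_continuousT => x; exact: (h x).2.
Qed.

(** The n-th iterate gains a factor M |x| / n at each integration, hence the
    summable bound. *)
Lemma picard_terms (R : realType) (a b : R -> R) (M v0 w0 : R) :
  continuous a -> continuous b ->
  (forall x, `|a x| <= M) -> (forall x, `|b x| <= M) ->
  exists g h : nat -> R -> R,
  [/\ g 0%N = cst v0, h 0%N = cst w0,
      forall n, g n.+1 0 = 0 /\ h n.+1 0 = 0,
      forall n (x : R), is_derive x 1 (g n.+1) (a x * h n x) /\
                        is_derive x 1 (h n.+1) (b x * g n x) &
      forall n x, `|g n x| <= (`|v0| + `|w0|) * ((M * `|x|) ^+ n / n`!%:R) /\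
                  `|h n x| <= (`|v0| + `|w0|) * ((M * `|x|) ^+ n / n`!%:R)].
Proof.
move=> ca cb aM bM.
have M0 : 0 <= M := le_trans (normr_ge0 _) (aM 0).
have [prim primP] : exists prim : (R -> R) -> (R -> R), forall f, continuous f ->
    prim f 0 = 0 /\ forall x : R, is_derive x 1 (prim f) (f x).
  have /choice[prim h] : forall f : R -> R, exists P : R -> R, continuous f ->
      P 0 = 0 /\ forall x : R, is_derive x 1 P (f x).
    move=> f; have [cf|ncf] := pselect (continuous f); last by exists f.
    by have [P P0 dP] := antiderivative cf; exists P.
  by exists prim.
(* Both components are iterated together, because each new one is a
   primitive of a coefficient times the other one. *)
pose u := fix u n : (R -> R) * (R -> R) := if n is m.+1 then
   (prim (fun x => a x * (u m).2 x), prim (fun x => b x * (u m).1 x))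
   else (cst v0, cst w0).
have uc n : continuous (u n).1 /\ continuous (u n).2.
  elim: n => [|n [c1 c2]] /=; first by split=> x; exact: cvg_cst.
  have [|_ d1] := primP (fun x => a x * (u n).2 x).
    by move=> x; apply: cvgM; [exact: ca|exact: c2].
  have [|_ d2] := primP (fun x => b x * (u n).1 x).
    by move=> x; apply: cvgM; [exact: cb|exact: c1].
  by split; exact: is_derive_continuousT.
have p1 n : (u n.+1).1 0 = 0 /\
    forall x : R, is_derive x 1 (u n.+1).1 (a x * (u n).2 x).
  by apply: primP => x; apply: cvgM; [exact: ca|exact: (uc n).2].
have p2 n : (u n.+1).2 0 = 0 /\
    forall x : R, is_derive x 1 (u n.+1).2 (b x * (u n).1 x).
  by apply: primP => x; apply: cvgM; [exact: cb|exact: (uc n).1].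
exists (fun n => (u n).1), (fun n => (u n).2); split => //.
- by move=> n; split; [exact: (p1 n).1|exact: (p2 n).1].
- by move=> n x; split; [exact: (p1 n).2|exact: (p2 n).2].
set C := _ + _; elim=> [|n IH] x.
  by rewrite /= expr0 divr1 mulr1 /C; split; rewrite ?lerDl ?lerDr.
have E m y : C * ((M * `|y|) ^+ m / m`!%:R) = (C * M ^+ m) * (`|y| ^+ m / m`!%:R).
  by rewrite exprMn; ring.
have step (c f : R -> R) y : (forall x, `|c x| <= M) ->
   (forall x, `|f x| <= C * ((M * `|x|) ^+ n / n`!%:R)) ->
   `|c y * f y| <= (C * M ^+ n.+1) * (`|y| ^+ n / n`!%:R).
  move=> cM fM; rewrite normrM.
  rewrite (_ : _ * _ * _ = M * (C * ((M * `|y|) ^+ n / n`!%:R))).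
    exact: ler_pM.
  by rewrite E exprS; ring.
rewrite !E; split.
- apply: (antiderivative_bound (p1 n).1 (p1 n).2) => y.
  apply: (step a (u n).2) => // z; exact: (IH z).2.
- apply: (antiderivative_bound (p2 n).1 (p2 n).2) => y.
  apply: (step b (u n).1) => // z; exact: (IH z).1.
Qed.

Lemma series_exp_le (R : realType) (x : R) n : 0 <= x ->
  \sum_(0 <= i < n) x ^+ i / i`!%:R <= expR x.
Proof.
move=> x0; apply: (nondecreasing_cvgn_le _ (is_cvg_series_exp_coeff x)).
by apply: nondecreasing_series => i _ _; exact: exp_coeff_ge0.
Qed.

(** The solution is the sum of the Picard iterates: the sum of the
    exponential series dominates it together with its partial sums. *)
Lemma linear_system_solution (R : realType) (a b : R -> R) (M v0 w0 : R) :
  continuous a -> continuous b ->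
  (forall x, `|a x| <= M) -> (forall x, `|b x| <= M) ->
  exists v w : R -> R, [/\ solves a b v w, v 0 = v0 & w 0 = w0].
Proof.
move=> ca cb aM bM.
have M0 : 0 <= M := le_trans (normr_ge0 _) (aM 0).
have [g [h [g0 h0 gh0 dgh Bgh]]] := picard_terms v0 w0 ca cb aM bM.
set C := `|v0| + `|w0| in Bgh; have C0 : 0 <= C by rewrite addr_ge0.
have general (f : nat -> R -> R) :
    (forall n x, `|f n x| <= C * ((M * `|x|) ^+ n / n`!%:R)) ->
    (forall n x (r : R), `|x| <= r ->
       `|series (f ^~ x) n| <= C * expR (M * r)) /\
    (forall x, cvgn (series (f ^~ x))).
  move=> fB; split.
    move=> n x r xr; apply: le_trans (ler_norm_sum _ _ _) _.
    apply: (@le_trans _ _ (\sum_(0 <= i < n) C * ((M * `|x|) ^+ i / i`!%:R))).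
      by apply: ler_sum => i _; exact: fB.
    rewrite -mulr_sumr ler_wpM2l//.
    apply: le_trans (series_exp_le _ _) _; first by rewrite mulr_ge0.
    by rewrite ler_expR ler_wpM2l.
  move=> x; apply: normed_cvg.
  apply: (series_le_cvg (v_ := C *: exp_coeff (M * `|x|))).
  - by move=> n /=.
  - by move=> n; rewrite mulr_ge0// exp_coeff_ge0// mulr_ge0.
  - by move=> n; exact: fB.
  - exact/is_cvg_seriesZ/is_cvg_series_exp_coeff.
have [Sb Sc] := general g (fun n x => (Bgh n x).1).
have [Tb Tc] := general h (fun n x => (Bgh n x).2).
pose S n x := series (g ^~ x) n; pose T n x := series (h ^~ x) n.
have dST (p q : nat -> R -> R) (k : R -> R) : (exists k0, p 0%N = cst k0) ->
    (forall n (x : R), is_derive x 1 (p n.+1) (k x * q n x)) ->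
    forall n (x : R), is_derive x 1 (fun y => series (p ^~ y) n.+1)
                                    (k x * series (q ^~ x) n).
  move=> [k0 p0] dp n x; elim: n => [|n IH].
    rewrite (_ : (fun y => _) = cst k0).
      by rewrite /series/= big_nil mulr0; exact: is_derive_cst.
    by apply/funext => y; rewrite /series/= big_nat1 p0.
  rewrite (_ : (fun y => _) =
     (fun y => series (p ^~ y) n.+1 + p n.+1 y)); last first.
    by apply/funext => y; rewrite /series/= big_nat_recr.
  by rewrite {2}/series/= big_nat_recr//= mulrDr; exact: is_derive_add.
have dS : forall n (x : R), is_derive x 1 (S n.+1) (a x * T n x).
  by apply: dST => //; [exists v0|move=> n x; exact: (dgh n x).1].
have dT : forall n (x : R), is_derive x 1 (T n.+1) (b x * S n x).
  by apply: dST => //; [exists w0|move=> n x; exact: (dgh n x).2].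
have lip (p q : nat -> R -> R) (k : R -> R) :
    (forall x, `|k x| <= M) -> p 0%N = cst 0 ->
    (forall n (x : R), is_derive x 1 (p n.+1) (k x * q n x)) ->
    (forall n (x r : R), `|x| <= r -> `|q n x| <= C * expR (M * r)) ->
    forall r : R, exists L, forall n x y, `|x| <= r -> `|y| <= r ->
     `|p n x - p n y| <= L * `|x - y|.
  move=> kM p0 dp qb r; exists (M * (C * expR (M * r))) => -[|n] x y xr yr.
    by rewrite p0 subrr normr0 !mulr_ge0 ?expR_ge0.
  apply: (@derive_bound_lipschitz _ _ _ (- r) r _ (fun z _ => dp n z)).
  - move=> z; rewrite -ler_norml => zr; rewrite normrM ler_pM//.
    exact: qb.
  - by rewrite -ler_norml.
  - by rewrite -ler_norml.
pose v x := limn (series (g ^~ x)); pose w x := limn (series (h ^~ x)).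
have val0 (p : nat -> R -> R) k : p 0%N = cst k ->
    (forall n, p n.+1 0 = 0) -> limn (series (p ^~ 0)) = k.
  move=> p0 pS; apply: cvg_lim => //; rewrite -(cvg_shiftS (series _)).
  rewrite (_ : (fun n => _) = cst k); first exact: cvg_cst.
  apply/funext => n; rewrite /series/= big_nat_recl//= p0 big1 ?addr0//.
exists v; exists w; split.
- move=> x; split.
    apply: (@is_derive_limit _ a v w S T M (fun r => C * expR (M * r))) => //.
    apply: (lip T S b) => //.
    by apply/funext => y; rewrite /T /series/= big_nil.
  apply: (@is_derive_limit _ b w v T S M (fun r => C * expR (M * r))) => //.
  apply: (lip S T a) => //.
  by apply/funext => y; rewrite /S /series/= big_nil.
- by apply: val0 => // n; exact: (gh0 n).1.
- by apply: val0 => // n; exact: (gh0 n).2.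
Qed.

(** * Fundamental systems *)

Lemma continuous_bounded_unit_itv (R : realType) (f : R -> R) : continuous f ->
  exists B, forall x, 0 <= x <= 1 -> `|f x| <= B.
Proof.
move=> cf; have [||c _ h] := @EVT_max R (fun x => `|f x|) 0 1.
- exact: ler01.
- by apply: continuous_subspaceT => x; apply: cvg_norm; exact: cf.
- by exists `|f c| => x x01; apply: h; rewrite in_itv.
Qed.

(** The function e^(- K x) E x - d x is nonincreasing. *)
Lemma gronwall (R : realType) (E dE : R -> R) (K d : R) : 0 <= K -> 0 <= d ->
  (forall x : R, is_derive x 1 E (dE x)) -> E 0 = 0 ->
  (forall x, 0 <= x <= 1 -> dE x <= K * E x + d) ->
  forall x, 0 <= x <= 1 -> E x <= expR K * d.
Proof.
move=> K0 d0 hE E0 hd x /andP[x0 x1].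
have dexp (z : R) : is_derive z 1 (fun y => expR (- K * y)) (expR (- K * z) * (- K)).
  by apply: is_derive_expR_comp; apply: (is_derive_eq
    (is_derive_scale _ (is_derive_id z (1 : R)))); rewrite mulr1.
have h1 (z : R) : 0 <= z <= x -> is_derive z 1 (fun y => expR (- K * y) * E y)
    (expR (- K * z) * (dE z - K * E z)).
  by move=> _; apply: (is_derive_eq (is_derive_mul (dexp z) (hE z))); ring.
have h2 (z : R) : 0 <= z <= x -> is_derive z 1 (fun y => d * y) d.
  by move=> _; apply: (is_derive_eq
    (is_derive_scale _ (is_derive_id z (1 : R)))); rewrite mulr1.
have := derive_le x0 h1 h2; rewrite E0 !mulr0 !subr0 => H.
have {}H : expR (- K * x) * E x <= d * x.
  apply: H => z /andP[z0 zx]; apply: (@le_trans _ _ (expR (- K * z) * d)).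
    by rewrite ler_wpM2l ?expR_ge0//;
      have := hd z; rewrite z0 (le_trans zx x1) => /(_ isT); lra.
  by rewrite ler_piMl// -expR0 ler_expR mulNr oppr_le0 mulr_ge0.
have {}H : E x <= expR (K * x) * d.
  rewrite -(ler_pM2l (expR_gt0 (- K * x))) mulrA -expRD mulNr addNr expR0 mul1r -mulNr.
  by apply: le_trans H _; rewrite ler_piMr.
by apply: le_trans H _; rewrite ler_wpM2r// ler_expR ler_piMr.
Qed.

(** The squared distance of two solutions satisfies the differential
    inequality of [gronwall], where the difference of the coefficients,
    multiplied by one of the solutions, is a source term. *)
Lemma solves_stable (R : realType) (a b b' v w v' w' : R -> R) (M d B : R) :
  solves a b v w -> solves a b' v' w' -> v 0 = v' 0 -> w 0 = w' 0 ->
  0 <= M -> (forall x, `|a x| <= M) -> (forall x, `|b x| <= M) ->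
  (forall x, `|b x - b' x| <= d) -> (forall x, 0 <= x <= 1 -> `|v' x| <= B) ->
  forall x, 0 <= x <= 1 ->
  (v x - v' x) ^+ 2 + (w x - w' x) ^+ 2 <= expR (M + M + 1) * (d * B) ^+ 2.
Proof.
move=> hv hv' v0 w0 M0 aM bM bd vB.
pose p x := v x - v' x; pose q x := w x - w' x.
apply: (@gronwall _ (fun x => p x ^+ 2 + q x ^+ 2)
  (fun x => 2 * p x * (a x * q x) + 2 * q x * (b x * v x - b' x * v' x))).
- lra.
- exact: sqr_ge0.
- move=> x; have dp : is_derive x 1 p (a x * q x).
    by apply: (is_derive_eq (is_derive_sub (hv x).1 (hv' x).1)); rewrite /q; ring.
  have dq : is_derive x 1 q (b x * v x - b' x * v' x).
    exact: (is_derive_sub (hv x).2 (hv' x).2).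
  by apply: (is_derive_eq
    (is_derive_add (is_derive_mul dp dp) (is_derive_mul dq dq))); ring.
- by rewrite /p /q v0 w0 !subrr expr0n/= addr0.
- move=> x x01.
  have -> : b x * v x - b' x * v' x = b x * p x + (b x - b' x) * v' x by rewrite /p; ring.
  have pq : 2 * (`|p x| * `|q x|) <= p x ^+ 2 + q x ^+ 2.
    by have := sqr_ge0 (`|p x| - `|q x|); rewrite -(real_normK (num_real (p x)))
      -(real_normK (num_real (q x))); lra.
  have cpq (c : R) : `|c| <= M -> 2 * (c * (p x * q x)) <= M * (p x ^+ 2 + q x ^+ 2).
    move=> cM; apply: (@le_trans _ _ (M * (2 * (`|p x| * `|q x|)))); last first.
      by rewrite ler_wpM2l.
    suff : c * (p x * q x) <= M * (`|p x| * `|q x|) by lra.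
    apply: le_trans (ler_norm _) _.
    by rewrite !normrM ler_wpM2r// mulr_ge0.
  have := cpq _ (aM x); have := cpq _ (bM x).
  have : 2 * (q x * ((b x - b' x) * v' x)) <= q x ^+ 2 + (d * B) ^+ 2.
    have : ((b x - b' x) * v' x) ^+ 2 <= (d * B) ^+ 2.
      rewrite -(real_normK (num_real (_ * _))) normrM ler_pXn2r ?nnegrE ?mulr_ge0//.
      + by apply: ler_pM => //; exact: vB.
      + exact: le_trans (normr_ge0 _) (bd x).
      + exact: le_trans (normr_ge0 _) (vB x x01).
    by have := sqr_ge0 (q x - (b x - b' x) * v' x); lra.
  have := sqr_ge0 (p x); lra.
Qed.

(** The entries of the matrix of solutions whose columns (fc, fC) and (fs, fS)
    start from the identity. *)
Record fundamental (R : realType) (a b : R -> R) := Fundamental {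
  fc : R -> R; fC : R -> R; fs : R -> R; fS : R -> R;
  fcP : solves a b fc fC; fsP : solves a b fs fS;
  fc0 : fc 0 = 1; fC0 : fC 0 = 0; fs0 : fs 0 = 0; fS0 : fS 0 = 1 }.

Lemma fundamental_exists (R : realType) (a b : R -> R) (M : R) :
  continuous a -> continuous b ->
  (forall x, `|a x| <= M) -> (forall x, `|b x| <= M) -> fundamental a b.
Proof.
move=> ca cb aM bM.
have /cid[c /cid[C [h1 h2 h3]]] := linear_system_solution 1 0 ca cb aM bM.
have /cid[s /cid[S [h4 h5 h6]]] := linear_system_solution 0 1 ca cb aM bM.
exact: (@Fundamental _ _ _ c C s S).
Qed.

Lemma wronskian_const (R : realType) (a b v w v' w' : R -> R) :
  solves a b v w -> solves a b v' w' ->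
  forall x, v x * w' x - w x * v' x = v 0 * w' 0 - w 0 * v' 0.
Proof.
move=> h h' x.
apply: (@is_derive_0_is_cst R (fun x => v x * w' x - w x * v' x)) => y.
by apply: (is_derive_eq
  (is_derive_sub (is_derive_mul (h y).1 (h' y).2) (is_derive_mul (h y).2 (h' y).1))); ring.
Qed.

Lemma wronskian_eq1 (R : realType) (a b : R -> R) (F : fundamental a b) x :
  fc F x * fS F x - fC F x * fs F x = 1.
Proof.
by rewrite (wronskian_const (fcP F) (fsP F)) fc0 fS0 fC0 fs0 mulr0 subr0 mulr1.
Qed.

(** A continuous function whose square is at least 1 cannot change sign. *)
Lemma sqr_ge1_ge1 (R : realType) (f : R -> R) x : 0 <= x ->
  continuous f -> f 0 = 1 -> (forall y, 0 <= y <= x -> 1 <= f y ^+ 2) -> 1 <= f x.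
Proof.
move=> x0 cf f0 h; have [fx|fx] := leP 0 (f x).
  by rewrite -(@ler_pXn2r _ 2)// ?nnegrE// expr1n; apply: h; rewrite x0 lexx.
have [||c + fc] := @IVT R f 0 x 0 x0.
- exact: continuous_subspaceT.
- by rewrite f0 ge_min (ltW fx) orbT le_max ler01.
by rewrite in_itv/= => /h; rewrite fc expr0n/= ler10.
Qed.

(** The product v w has the derivative a w^2 + b v^2 and is therefore
    nonnegative; and 2 a v w and 2 b v w are the derivatives of v^2 and
    w^2. *)
Lemma solves_cone_sqr_le (R : realType) (a b v w : R -> R) (x : R) :
  solves a b v w -> (forall y, 0 <= a y) -> (forall y, 0 <= b y) ->
  0 <= v 0 * w 0 -> 0 <= x -> v 0 ^+ 2 <= v x ^+ 2 /\ w 0 ^+ 2 <= w x ^+ 2.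
Proof.
move=> h a0 b0 vw0 x0.
have vw y : 0 <= y -> 0 <= v y * w y.
  move=> y0; apply: le_trans vw0 _.
  apply: (derive_ge0_le y0 (f := fun x => v x * w x)
    (df := fun z => a z * w z ^+ 2 + b z * v z ^+ 2)) => z _.
    by apply: (is_derive_eq (is_derive_mul (h z).1 (h z).2)); ring.
  by rewrite addr_ge0// mulr_ge0// sqr_ge0.
split.
- apply: (derive_ge0_le x0 (f := fun x => v x ^+ 2)
    (df := fun z => 2 * (a z * (v z * w z)))) => z /andP[z0 _].
    by apply: (is_derive_eq (is_derive_mul (h z).1 (h z).1)); ring.
  by rewrite mulr_ge0// mulr_ge0// vw.
- apply: (derive_ge0_le x0 (f := fun x => w x ^+ 2)
    (df := fun z => 2 * (b z * (v z * w z)))) => z /andP[z0 _].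
    by apply: (is_derive_eq (is_derive_mul (h z).2 (h z).2)); ring.
  by rewrite mulr_ge0// mulr_ge0// vw.
Qed.

(** * Lower bound for the quadratic form *)

(** The quotient w / v solves the Riccati equation of the system. *)
Lemma is_derive_riccati (R : realType) (a b v w : R -> R) (x : R) : solves a b v w ->
  v x != 0 -> is_derive x 1 (fun z => w z / v z) (b x - a x * (w x / v x) ^+ 2).
Proof.
move=> h vx; have hV : is_derive x 1 (fun z => (v z)^-1) (- (v x) ^- 2 * (a x * w x)).
  exact: (is_deriveV vx (h x).1).
by apply: (is_derive_eq (is_derive_mul (h x).2 hV)); field.
Qed.

(** Let (y, Y) be the solution for which y has the boundary values of psi, and
    let h = psi - y, which vanishes at 0 and at 1.  For a positive solution v with second
    component w and u = w / v, the integrand is the derivative of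
    Y y + 2 Y h + u h^2 plus the square (h' - a u h)^2 / a (Picone's
    identity).  Hence the integral is at least Y 1 * y 1 - Y 0 * y 0, which
    the Wronskian relation brings to the stated form.  As s vanishes at 0, the
    positive solution has to be a perturbation of s by a small multiple of c. *)
Lemma picone_lower_bound (R : realType) (a b : R -> R) (F : fundamental a b) (eta : R)
    (psi dpsi J : R -> R) :
  (forall x, 0 < a x) -> continuous a -> 0 < eta ->
  (forall x, 0 <= x <= 1 -> eta * x <= fs F x) ->
  (forall x : R, is_derive x 1 psi (dpsi x)) ->
  (forall x : R, is_derive x 1 J (dpsi x ^+ 2 / a x + b x * psi x ^+ 2)) ->
  (psi 1 ^+ 2 * fS F 1 - 2 * psi 0 * psi 1 + fc F 1 * psi 0 ^+ 2) / fs F 1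
    <= J 1 - J 0.
Proof.
move=> a_gt0 ca eta0 hs dpsiP hJ.
have s1 : 0 < fs F 1.
  by have := hs 1; rewrite mulr1 ler01 lexx => /(_ isT); exact: lt_le_trans.
have [L hL] : exists L, forall x, 0 <= x <= 1 -> `|a x * fC F x| <= L.
  apply: (@continuous_bounded_unit_itv _ (fun x => a x * fC F x)) => x.
  apply: cvgM; first exact: ca.
  exact: (is_derive_continuous (fcP F x).2).
have L0 : 0 <= L by apply: le_trans (hL 0 _); rewrite // lexx ler01.
(* As c x >= 1 - L x and s x >= eta x, the function s + d c is at least d as
   soon as d L <= eta. *)
pose d := eta / (L + 1).
have L1 : 0 < L + 1 by rewrite ltr_wpDl.
have d0 : 0 < d by rewrite divr_gt0.
have dE : d * (L + 1) = eta by rewrite divfK// gt_eqF.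
have dL : d * L <= eta by lra.
pose v x := fs F x + d * fc F x; pose w x := fS F x + d * fC F x.
have vw : solves a b v w.
  move=> x; split.
    by apply: (is_derive_eq
      (is_derive_add (fsP F x).1 (is_derive_scale d (fcP F x).1))); rewrite /w; ring.
  by apply: (is_derive_eq
    (is_derive_add (fsP F x).2 (is_derive_scale d (fcP F x).2))); rewrite /v; ring.
have vpos x : 0 <= x <= 1 -> 0 < v x.
  move=> x01; move/andP: (x01) => [x0 x1].
  have := derive_bound_lipschitz (fun z _ => (fcP F z).1) hL x01 (_ : 0 <= 0 <= 1).
  rewrite lexx ler01 => /(_ isT); rewrite fc0 subr0 (ger0_norm x0) ler_norml.
  move=> /andP[hc _]; have := hs x x01; rewrite /v.
  have : d * (1 - L * x) <= d * fc F x by rewrite ler_pM2l//; lra.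
  have : d * L * x <= eta * x by rewrite ler_wpM2r.
  lra.
pose g := (psi 1 - psi 0 * fc F 1) / fs F 1.
pose y x := psi 0 * fc F x + g * fs F x; pose Y x := psi 0 * fC F x + g * fS F x.
have yY : solves a b y Y.
  move=> x; split.
    by apply: (is_derive_eq
      (is_derive_add (is_derive_scale _ (fcP F x).1) (is_derive_scale g (fsP F x).1)));
      rewrite /Y; ring.
  by apply: (is_derive_eq
    (is_derive_add (is_derive_scale _ (fcP F x).2) (is_derive_scale g (fsP F x).2)));
    rewrite /y; ring.
pose h x := psi x - y x; pose dh x := dpsi x - a x * Y x.
have hh (x : R) : is_derive x 1 h (dh x).
  exact: (is_derive_sub (dpsiP x) (yY x).1).
pose u x := w x / v x.
pose P x := Y x * y x + 2 * (Y x * h x) + u x * (h x * h x).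
have h0 : h 0 = 0 by rewrite /h /y fc0 fs0; ring.
have h1 : h 1 = 0 by rewrite /h /y /g divfK ?gt_eqF// [psi 0 * _ + _]addrC subrK subrr.
have PE : P 1 - P 0 =
    (psi 1 ^+ 2 * fS F 1 - 2 * psi 0 * psi 1 + fc F 1 * psi 0 ^+ 2) / fs F 1.
  rewrite /P h0 h1 !mulr0 !addr0 /Y /y fC0 fS0 fc0 fs0 /g.
  have := wronskian_eq1 F 1; have := gt_eqF s1.
  move: (fc F 1) (fC F 1) (fs F 1) (fS F 1) (psi 1) (psi 0) => p1 p2 p3 p4 be al p30 det.
  have -> : p2 = (p1 * p4 - 1) / p3 by rewrite -det; field; rewrite p30.
  by field; rewrite p30.
rewrite -PE; apply: (derive_le ler01 (f := P) (g := J)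
  (dg := fun x => dpsi x ^+ 2 / a x + b x * psi x ^+ 2)
  (df := fun x => b x * (psi x ^+ 2) + dpsi x ^+ 2 / a x
     - (dh x - a x * u x * h x) ^+ 2 / a x)).
- move=> x x01; have vx : v x != 0 by rewrite gt_eqF// vpos.
  have ax : a x != 0 by rewrite gt_eqF.
  apply: (is_derive_eq (is_derive_add (is_derive_add (is_derive_mul (yY x).2 (yY x).1)
    (is_derive_scale 2 (is_derive_mul (yY x).2 (hh x))))
    (is_derive_mul (is_derive_riccati vw vx) (is_derive_mul (hh x) (hh x))))).
  by rewrite -/(u x) /dh /h; field.
- move=> x _; have : 0 <= (dh x - a x * u x * h x) ^+ 2 / a x.
    by rewrite divr_ge0 ?sqr_ge0// ltW.
  lra.
Qed.

(** The two real test functions cos (tau x) and sin (tau x) are the real and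
    imaginary parts of e^(i tau x).  The sum of the two boundary terms of
    [picone_lower_bound] is (D - 2 cos tau) / s 1, with D the trace of the
    matrix of solutions at 1. *)
Lemma plane_wave_energy (R : realType) (a b : R -> R) (F : fundamental a b)
    (eta tau : R) (J : R -> R) :
  (forall x, 0 < a x) -> continuous a -> continuous b -> 0 < eta ->
  (forall x, 0 <= x <= 1 -> eta * x <= fs F x) ->
  2 * cos tau <= fc F 1 + fS F 1 ->
  (forall x : R, is_derive x 1 J (tau ^+ 2 / a x + b x)) -> J 0 <= J 1.
Proof.
move=> a_gt0 ca cb eta0 hs hD hJ.
have s1 : 0 < fs F 1.
  by have := hs 1; rewrite mulr1 ler01 lexx => /(_ isT); exact: lt_le_trans.
have dlin (x : R) : is_derive x 1 (fun z => tau * z) tau.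
  by apply: (is_derive_eq (is_derive_scale tau (is_derive_id x (1 : R)))); rewrite mulr1.
pose psi1 x := cos (tau * x); pose psi2 x := sin (tau * x).
have d1 (x : R) : is_derive x 1 psi1 (- (tau * psi2 x)).
  have := @is_derive1_comp R (@cos R) _ x _ _ (is_derive_cos (tau * x)) (dlin x).
  by move=> h; apply: (is_derive_eq h); rewrite /psi2; ring.
have d2 (x : R) : is_derive x 1 psi2 (tau * psi1 x).
  have := @is_derive1_comp R (@sin R) _ x _ _ (is_derive_sin (tau * x)) (dlin x).
  by move=> h; apply: (is_derive_eq h); rewrite /psi1; ring.
have c1 : continuous psi1 := is_derive_continuousT d1.
have c2 : continuous psi2 := is_derive_continuousT d2.
have [J1 _ hJ1] : exists2 J1 : R -> R, J1 0 = 0 & forall x : R, is_derive x 1 J1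
    ((- (tau * psi2 x)) ^+ 2 / a x + b x * psi1 x ^+ 2).
  apply: antiderivative => x; apply: cvgD.
    apply: cvgM; last by apply: cvgV; [rewrite gt_eqF|exact: ca].
    apply: cvgM; apply: cvgN; apply: cvgM; [exact: cvg_cst|exact: c2|exact: cvg_cst|exact: c2].
  by apply: cvgM; [exact: cb|apply: cvgM; exact: c1].
have hJ2 (x : R) : is_derive x 1 (fun z => J z - J1 z)
    ((tau * psi1 x) ^+ 2 / a x + b x * psi2 x ^+ 2).
  apply: (is_derive_eq (is_derive_sub (hJ x) (hJ1 x))).
  have e : psi2 x ^+ 2 = 1 - psi1 x ^+ 2 by rewrite /psi2 sin2cos2.
  by rewrite sqrrN !exprMn e; ring.
have := picone_lower_bound a_gt0 ca eta0 hs d1 hJ1;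
  have := picone_lower_bound a_gt0 ca eta0 hs d2 hJ2.
rewrite /psi1 /psi2 !mulr0 !mulr1 cos0 sin0 expr0n/= expr1n !mulr0 mul0r subr0 addr0 !mulr1.
move=> h2 h1; have {h1 h2} := lerD h2 h1.
rewrite -mulrDl (_ : _ + (_ - _ + _) = fc F 1 + fS F 1 - 2 * cos tau); last first.
  have -> : sin tau ^+ 2 = 1 - cos tau ^+ 2 by rewrite sin2cos2.
  by ring.
have : 0 <= (fc F 1 + fS F 1 - 2 * cos tau) / fs F 1.
  by rewrite divr_ge0// ?subr_ge0// ltW.
lra.
Qed.

(** * Discriminant and quadratic form below the spectrum *)

(** The system v' = a w, w' = (k - nu r) v, that is (v' / a)' = (k - nu r) v,
    with a spectral parameter nu. *)
Section SturmLiouville.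
Context {R : realType} (a k r : R -> R) (M r0 : R).
Context (ca : continuous a).
Context (ck : continuous k).
Context (cr : continuous r).
Context (aM : forall x, `|a x| <= M).
Context (kM : forall x, `|k x| <= M).
Context (rM : forall x, `|r x| <= M).
Context (a_gt0 : forall x, 0 < a x).
Context (r0_gt0 : 0 < r0).
Context (r0_le : forall x, r0 <= r x).

Definition pot (nu x : R) : R := k x - nu * r x.

Let M0 : 0 <= M := le_trans (normr_ge0 _) (aM 0).

Lemma pot_bound nu x : `|pot nu x| <= M + `|nu| * M.
Proof.
apply: le_trans (ler_normB _ _) _; rewrite lerD// normrM.
by rewrite ler_wpM2l.
Qed.

Lemma pot_continuous nu : continuous (pot nu).
Proof.
move=> x; apply: cvgB; first exact: ck.
by apply: cvgM; [exact: cvg_cst|exact: cr].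
Qed.

Lemma fundamental_at (nu : R) : fundamental a (pot nu).
Proof.
apply: (@fundamental_exists _ _ _ (M + `|nu| * M)) => //.
- exact: pot_continuous.
- by move=> x; rewrite (le_trans (aM x))// lerDl mulr_ge0.
- exact: pot_bound.
Qed.

Local Notation c nu := (fc (fundamental_at nu)).
Local Notation C nu := (fC (fundamental_at nu)).
Local Notation s nu := (fs (fundamental_at nu)).
Local Notation S nu := (fS (fundamental_at nu)).

Definition discriminant nu := c nu 1 + S nu 1.

(** Solutions with fixed initial values depend continuously on the spectral
    parameter, uniformly on [0, 1]. *)
Lemma solves_locally_lipschitz (v w : R -> R -> R) :
  (forall nu, solves a (pot nu) (v nu) (w nu)) ->
  (forall nu nu', v nu 0 = v nu' 0) -> (forall nu nu', w nu 0 = w nu' 0) ->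
  forall nu, exists2 L, 0 <= L & forall nu', `|nu' - nu| <= 1 ->
    forall x, 0 <= x <= 1 -> `|v nu' x - v nu x| <= L * `|nu' - nu| /\
                             `|w nu' x - w nu x| <= L * `|nu' - nu|.
Proof.
(* A bound for the coefficients at all parameters at distance at most 1
   from nu. *)
move=> h v0 w0 nu; pose N := M + (`|nu| + 1) * M.
have [B vB] := continuous_bounded_unit_itv (solves_continuous (h nu)).1.
have B0 : 0 <= B by apply: le_trans (vB 0 _) => //; rewrite lexx ler01.
pose L := expR (N + N + 1) * (M * B).
have L0 : 0 <= L by rewrite mulr_ge0 ?expR_ge0// mulr_ge0.
have N0 : 0 <= N by rewrite addr_ge0 ?mulr_ge0 ?addr_ge0.
exists L => // nu' hnu x x01.
have bound : M + `|nu'| * M <= N.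
  rewrite lerD2l ler_wpM2r//.
  by have := ler_normD (nu' - nu) nu; rewrite subrK; lra.
have aN (y : R) : `|a y| <= N by rewrite (le_trans (aM y))// lerDl mulr_ge0// addr_ge0.
have bN (y : R) : `|pot nu' y| <= N by exact: (le_trans (pot_bound _ _) bound).
have bd (y : R) : `|pot nu' y - pot nu y| <= `|nu' - nu| * M.
  have -> : pot nu' y - pot nu y = (nu - nu') * r y by rewrite /pot; ring.
  by rewrite normrM distrC ler_wpM2l.
have := solves_stable (h nu') (h nu) (v0 nu' nu) (w0 nu' nu) N0 aN bN bd vB x01.
set e := expR _; move=> H.
have e1 : 1 <= e by rewrite -expR0 ler_expR; lra.
have E : e * (`|nu' - nu| * M * B) ^+ 2 <= (L * `|nu' - nu|) ^+ 2.
  have -> : L * `|nu' - nu| = e * (`|nu' - nu| * M * B) by rewrite /L -/e; ring.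
  by rewrite [leRHS]exprMn ler_wpM2r ?sqr_ge0// expr2 ler_peMl// (le_trans ler01).
have main (z : R) : z ^+ 2 <= (L * `|nu' - nu|) ^+ 2 -> `|z| <= L * `|nu' - nu|.
  by rewrite -(real_normK (num_real z)) ler_pXn2r// nnegrE // mulr_ge0.
by split; apply: main; apply: le_trans (le_trans H E);
  rewrite ?lerDl ?lerDr sqr_ge0.
Qed.

Lemma s_locally_lipschitz nu : exists2 L, 0 <= L & forall nu', `|nu' - nu| <= 1 ->
    forall x, 0 <= x <= 1 -> `|s nu' x - s nu x| <= L * `|nu' - nu| /\
                             `|S nu' x - S nu x| <= L * `|nu' - nu|.
Proof.
apply: (solves_locally_lipschitz (v := fun nu => s nu) (w := fun nu => S nu)).
- by move=> ?; exact: fsP.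
- by move=> *; rewrite !fs0.
- by move=> *; rewrite !fS0.
Qed.

Lemma c_locally_lipschitz nu : exists2 L, 0 <= L & forall nu', `|nu' - nu| <= 1 ->
    forall x, 0 <= x <= 1 -> `|c nu' x - c nu x| <= L * `|nu' - nu| /\
                             `|C nu' x - C nu x| <= L * `|nu' - nu|.
Proof.
apply: (solves_locally_lipschitz (v := fun nu => c nu) (w := fun nu => C nu)).
- by move=> ?; exact: fcP.
- by move=> *; rewrite !fc0.
- by move=> *; rewrite !fC0.
Qed.

Lemma discriminant_continuous : continuous discriminant.
Proof.
move=> nu; have [L L0 hL] := c_locally_lipschitz nu.
have [L' L'0 hL'] := s_locally_lipschitz nu.
apply/cvgrPdist_le => e e0; near=> nu'.
have h1 : `|nu' - nu| <= 1 by apply/ltW; near: nu'; exact: near_dist.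
have hd : `|nu' - nu| < e / (L + L' + 1).
  by near: nu'; apply: near_dist; rewrite divr_gt0// ltr_wpDl// addr_ge0.
have i01 : 0 <= (1 : R) <= 1 by rewrite ler01 lexx.
have [hc _] := hL _ h1 _ i01; have [_ hS] := hL' _ h1 _ i01.
rewrite distrC /discriminant opprD addrACA; apply: le_trans (ler_normD _ _) _.
apply: (@le_trans _ _ ((L + L' + 1) * `|nu' - nu|)).
  by have := normr_ge0 (nu' - nu); lra.
rewrite mulrC -ler_pdivlMr ?ltr_wpDl ?addr_ge0//; exact: ltW.
Unshelve. all: by end_near. Qed.

(** Here the second coefficient k - nu r is nonnegative, so that the solutions
    stay in the positive quadrant. *)
Lemma very_negative_regime nu : nu <= - (M / r0) ->
  2 <= discriminant nu /\ forall x, 0 < x <= 1 -> 0 < s nu x.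
Proof.
move=> hnu; have b0 x : 0 <= pot nu x.
  have h1 : M <= - nu * r0 by rewrite -ler_pdivrMr//; lra.
  have h2 : - nu * r0 <= - nu * r x.
    have : 0 <= M / r0 by rewrite divr_ge0// ltW.
    by move=> ?; rewrite ler_wpM2l//; lra.
  by have := kM x; rewrite ler_norml /pot => /andP[]; lra.
have a0 x : 0 <= a x by exact: ltW.
have [cc _] := solves_continuous (fcP (fundamental_at nu)).
have [_ cS] := solves_continuous (fsP (fundamental_at nu)).
have c1 x : 0 <= x -> 1 <= c nu x.
  move=> x0; apply: sqr_ge1_ge1 => //; first exact: fc0.
  move=> y /andP[y0 _].
  have [] := solves_cone_sqr_le (fcP (fundamental_at nu)) a0 b0 _ y0;
    first by rewrite fC0 mulr0.
  by rewrite fc0 expr1n.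
have S1 x : 0 <= x -> 1 <= S nu x.
  move=> x0; apply: sqr_ge1_ge1 => //; first exact: fS0.
  move=> y /andP[y0 _].
  have [] := solves_cone_sqr_le (fsP (fundamental_at nu)) a0 b0 _ y0;
    first by rewrite fs0 mul0r.
  by rewrite fS0 expr1n.
split; first by have := c1 _ ler01; have := S1 _ ler01; rewrite /discriminant; lra.
move=> x /andP[x0 x1].
have [z /andP[z0 _]] := mean_value (ltW x0) (fun y _ => (fsP (fundamental_at nu) y).1).
rewrite fs0 !subr0 => ->; rewrite mulr_gt0// mulr_gt0//.
exact: lt_le_trans ltr01 (S1 _ z0).
Qed.

(** The quotient s x / x extends continuously to [0, 1] with value s' 0 > 0 at
    0, so that it has a positive minimum. *)
Lemma positive_linear_below nu : (forall x, 0 < x <= 1 -> 0 < s nu x) ->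
  exists2 eta, 0 < eta & forall x, 0 <= x <= 1 -> eta * x <= s nu x.
Proof.
move=> spos.
have := (fsP (fundamental_at nu) 0).1; rewrite fS0 mulr1.
move=> /is_derive1_caratheodory[g [sg cg g0]].
have {}sg x : s nu x = g x * x by have := sg x; rewrite fs0 !subr0.
have cgall : {within `[0, 1], continuous g}.
  apply: continuous_in_subspaceT => x; rewrite inE/= in_itv/= => /andP[x0 x1].
  have [->//|xn0] := eqVneq x 0.
  have xpos : 0 < x by rewrite lt_def xn0.
  have h : g z @[z --> x] --> s nu x / x.
    apply: (@cvg_trans _ ((s nu z / z) @[z --> x])).
      apply: near_eq_cvg; near=> z; rewrite sg mulfK//.
      by rewrite gt_eqF//; near: z; exact: lt_nbhsr.
    have h1 := (solves_continuous (fsP (fundamental_at nu))).1 x.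
    exact: (cvgM h1 (cvgV xn0 cvg_id)).
  by have := h; rewrite sg mulfK.
have [z + hz] := EVT_min ler01 cgall; rewrite in_itv/= => /andP[z0 z1].
exists (g z).
  have [->|zn0] := eqVneq z 0; first by rewrite g0.
  have zpos : 0 < z by rewrite lt_def zn0.
  by have := spos z; rewrite zpos z1 sg pmulr_lgt0// => /(_ isT).
move=> x /andP[x0 x1]; rewrite sg ler_wpM2r//; apply: hz.
by rewrite in_itv/= x0.
Unshelve. all: by end_near. Qed.

(** Both solutions vanish at 0, so that their difference is at most of order
    |nu' - nu| x; this is what makes the linear lower bound for s stable up to
    the end point 0. *)
Lemma positive_open nu : (forall x, 0 < x <= 1 -> 0 < s nu x) ->
  exists2 e, 0 < e & forall nu', `|nu' - nu| < e ->
     forall x, 0 < x <= 1 -> 0 < s nu' x.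
Proof.
move=> /positive_linear_below[eta eta0 sx].
have [L L0 hL] := s_locally_lipschitz nu.
have ML : 0 < M * L + 1 by rewrite ltr_wpDl// mulr_ge0.
exists (Num.min 1 (eta / (M * L + 1))); first by rewrite lt_min ltr01 divr_gt0.
move=> nu'; rewrite lt_min => /andP[/ltW h1 h2] x /andP[x0 x1].
have hx y : 0 <= y <= x -> is_derive y 1 (fun z => s nu' z - s nu z)
     (a y * (S nu' y - S nu y)).
  move=> _; apply: (is_derive_eq
    (is_derive_sub (fsP (fundamental_at nu') y).1 (fsP (fundamental_at nu) y).1)).
  by ring.
have [y /andP[y0 yx]] := mean_value (ltW x0) hx.
rewrite !fs0 !subr0 => E.
have y01 : 0 <= y <= 1 by rewrite y0 (le_trans yx).
have : `|s nu' x - s nu x| <= M * (L * `|nu' - nu|) * x.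
  rewrite E normrM (ger0_norm (ltW x0)) ler_wpM2r ?(ltW x0)// normrM.
  by apply: ler_pM => //; exact: (hL _ h1 _ y01).2.
have : M * (L * `|nu' - nu|) * x < eta * x.
  rewrite ltr_pM2r//; apply: (@le_lt_trans _ _ ((M * L + 1) * `|nu' - nu|)).
    by have := normr_ge0 (nu' - nu); lra.
  by rewrite mulrC -ltr_pdivlMr.
have := sx x; rewrite (ltW x0) x1 => /(_ isT).
by rewrite ler_norml => + + /andP[]; lra.
Qed.

(** Let nu2 be the infimum of the parameters for which positivity fails; it
    exists by [very_negative_regime].  By openness positivity fails at nu2
    itself, where s is still nonnegative as a limit of positive functions.  A
    zero of s in ]0, 1[ would be a double zero, which the Wronskian forbids;
    so s vanishes at 1 with S 1 < 0, and c 1 * S 1 = 1 forces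
    c 1 + S 1 <= - 2. *)
Lemma positive_of_discriminant nu1 :
  (forall nu, nu <= nu1 -> - 2 < discriminant nu) ->
  forall x, 0 < x <= 1 -> 0 < s nu1 x.
Proof.
move=> hD.
pose Q nu := forall x, 0 < x <= 1 -> 0 < s nu x.
apply: (contrapT (P := Q nu1)) => nQ1.
pose A := [set nu | nu <= nu1 /\ ~ Q nu].
have A0 : A !=set0 by exists nu1; split.
have lbA : has_lbound A.
  exists (- (M / r0)) => nu [_ nQ]; rewrite leNgt; apply/negP => /ltW.
  by move=> /very_negative_regime[_ /nQ].
have hinf : has_inf A by split.
pose nu2 := inf A.
have nu21 : nu2 <= nu1 by apply: ge_inf => //; split.
have below nu : nu < nu2 -> Q nu.
  move=> h; apply: contrapT => nQ; have : nu2 <= nu.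
    by apply: ge_inf => //; split => //; lra.
  lra.
have nQ2 : ~ Q nu2.
  move=> /positive_open[e e0 he].
  have [nu [nunu1 nQ] hnu] := inf_adherent e0 hinf.
  have h2 : nu2 <= nu by apply: ge_inf => //; split.
  apply: nQ; apply: he.
  by rewrite ger0_norm ?subr_ge0//; rewrite -/nu2 in hnu; lra.
have sge0 x : 0 <= x <= 1 -> 0 <= s nu2 x.
  move=> x01; rewrite leNgt; apply/negP => sneg.
  have [L L0 hL] := s_locally_lipschitz nu2.
  (* A step to the left that keeps the value at x below half of s nu2 x, while
   positivity holds there. *)
  pose d := Num.min 1 (- s nu2 x / 2 / (L + 1)).
  have L1 : 0 < L + 1 by rewrite ltr_wpDl.
  have d0 : 0 < d by rewrite lt_min ltr01 !divr_gt0// oppr_gt0.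
  have d1 : d <= 1 by rewrite ge_min lexx.
  have Ld : (L + 1) * d <= - s nu2 x / 2.
    by rewrite mulrC -ler_pdivlMr// ge_min lexx orbT.
  have e1 : `|nu2 - d - nu2| = d by rewrite addrAC subrr add0r normrN gtr0_norm.
  have := (hL (nu2 - d)); rewrite e1 => /(_ d1 _ x01)[+ _].
  rewrite ler_norml => /andP[_].
  have xn0 : x != 0 by apply: contraTneq sneg => ->; rewrite fs0 ltxx.
  have : 0 < s (nu2 - d) x.
    apply: below; first lra.
    by move/andP : x01 => [x0 ->]; rewrite lt_def xn0 x0.
  lra.
have [x [x01 sx]] : exists x, 0 < x <= 1 /\ s nu2 x <= 0.
  apply: contrapT => H; apply: nQ2 => x x01; rewrite ltNge; apply/negP => sx.
  by apply: H; exists x.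
have s0 : s nu2 x = 0.
  apply/eqP; rewrite eq_le sx sge0//.
  by move/andP : x01 => [/ltW -> ->].
have [d0 d1] := derive_at_zero_of_nonneg (fsP (fundamental_at nu2) x).1 s0 x01 sge0.
have det := wronskian_eq1 (fundamental_at nu2) x; rewrite s0 mulr0 subr0 in det.
have x1 : x = 1.
  apply/eqP; rewrite eq_le; move/andP : x01 => [_ ->]/=; rewrite leNgt; apply/negP.
  move=> /d1/eqP; rewrite mulf_eq0 gt_eqF//= => /eqP SX.
  by move: det; rewrite SX mulr0 => /eqP; rewrite eq_sym oner_eq0.
have Sle : S nu2 x <= 0 by rewrite -(ler_pM2l (a_gt0 x)) mulr0.
have := hD _ nu21; rewrite /discriminant -x1.
have Slt : S nu2 x < 0.
  rewrite lt_neqAle Sle andbT; apply: contra_eq_neq det => ->.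
  by rewrite mulr0 eq_sym oner_eq0.
have := sqr_ge0 (S nu2 x + 1).
have : (c nu2 x + S nu2 x + 2) * S nu2 x = 1 + S nu2 x ^+ 2 + 2 * S nu2 x.
  by rewrite -det; ring.
move=> h1 h2 h3.
have : (c nu2 x + S nu2 x + 2) * S nu2 x < 0 by rewrite pmulr_rlt0//; lra.
rewrite h1; lra.
Qed.

(** The discriminant is at least 2 far to the left, and by continuity it cannot
    come below 2 cos tau without taking this value. *)
Lemma discriminant_gt (tau nu0 : R) :
  (forall nu, nu < nu0 -> discriminant nu <> 2 * cos tau) ->
  forall nu, nu < nu0 -> 2 * cos tau < discriminant nu.
Proof.
move=> hD nu hnu; rewrite ltNge; apply/negP => Dnu.
pose nu1 := Num.min nu (- (M / r0)).
have [n1 n2] : nu1 <= nu /\ nu1 <= - (M / r0) by rewrite /nu1 !ge_min !lexx orbT.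
have [D2 _] := very_negative_regime n2.
have cos1 : 2 * cos tau <= 2 by have := cos_le1 tau; lra.
have [||z + Dz] := @IVT R discriminant nu1 nu (2 * cos tau) n1.
- by apply: continuous_subspaceT; exact: discriminant_continuous.
- rewrite ge_min Dnu orbT/= le_max; apply/orP; left; exact: le_trans cos1 D2.
by rewrite in_itv/= => /andP[_ zn]; apply: (hD z) => //; exact: le_lt_trans zn hnu.
Qed.

(** The equality c 1 + S 1 = 2 cos tau would mean that e^(i tau) is an
    eigenvalue of the matrix of solutions at 1. *)
Lemma plane_wave_energy_below (tau nu0 : R) :
  (forall nu, nu < nu0 -> forall Phi : fundamental a (pot nu),
     fc Phi 1 + fS Phi 1 <> 2 * cos tau) ->
  forall nu, nu < nu0 -> forall J : R -> R,
  (forall x : R, is_derive x 1 J (tau ^+ 2 / a x + pot nu x)) -> J 0 <= J 1.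
Proof.
move=> hD nu hnu J hJ;
  have D_gt := discriminant_gt (fun nu h => hD nu h (fundamental_at nu)).
have spos : forall x, 0 < x <= 1 -> 0 < s nu x.
  apply: positive_of_discriminant => nu' hnu'.
  apply: le_lt_trans (D_gt _ (le_lt_trans hnu' hnu)).
  by have := cos_geN1 tau; lra.
have [eta eta0 hs] := positive_linear_below spos.
apply: (@plane_wave_energy _ _ (pot nu) (fundamental_at nu) eta tau) => //.
- exact: pot_continuous.
- exact/ltW/D_gt.
Qed.

End SturmLiouville.

(** * Absolutely continuous functions *)

Section Primitive.
Context {R : realType} (f : R -> R).
Local Notation mu := (@lebesgue_measure R).
Context (intf : mu.-integrable setT (EFin \o f)).

Definition primitive (x : R) : R := \int[mu]_(s in `]-oo, x]) f s.

Lemma integrable_on (A : set R) : measurable A -> mu.-integrable A (EFin \o f).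
Proof. by move=> mA; apply: integrableS intf. Qed.

Lemma primitive_increment l r : l <= r ->
  primitive r - primitive l = \int[mu]_(s in `]l, r[) f s.
Proof.
move=> lr; rewrite /primitive Rintegral_itvB ?bnd_simp//; last exact: integrable_on.
by rewrite -Rintegral_itv_bndo_bndc//; exact: integrable_on.
Qed.

(** The increments over disjoint intervals add up to at most the integral of
    |f| over their union, which is small when the union has small measure. *)
Lemma primitive_absolutely_continuous (a b : R) : absolutely_continuous_on a b primitive.
Proof.
move=> e e0; have [d [d0 hd]] := integral_normr_continuous intf e0.
exists d => // n l r lr triv sd.
pose I (i : 'I_n) : set R := `](l i), (r i)[%classic.
have mI i : measurable (I i) by exact: measurable_itv.
pose A : set R := \big[setU/set0]_(i < n) I i.
have mA : measurable A by apply: bigsetU_measurable.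
have muI i : mu (I i) = (r i - l i)%:E.
  rewrite /I lebesgue_measure_itv/= lte_fin.
  have [_ [+ _]] := lr i; rewrite le_eqVlt => /orP[/eqP ->|->]; last by rewrite EFinN.
  by rewrite ltxx subrr.
have Ad : (mu A < d%:E)%E.
  rewrite /A measure_bigsetU_ord// (eq_bigr (fun i => (r i - l i)%:E)) => [|i _].
    by rewrite sumEFin lte_fin.
  exact: muI.
apply: le_lt_trans (hd A mA Ad).
have intn : mu.-integrable setT (EFin \o (fun x => `|f x|)).
  exact: integrable_norm intf.
have inI i : mu.-integrable (I i) (EFin \o (fun x => `|f x|)).
  apply: integrableS intn => //; exact: mI.
have -> : \int[mu]_(x in A) `|f x| = \sum_(i < n) \int[mu]_(x in I i) `|f x|.
  rewrite /Rintegral /A integral_bigsetU_EFin//=.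
  - rewrite sum_fine//= => i _.
    by apply: (integrable_fin_num _ (inI i)); exact: mI.
  - exact: index_enum_uniq.
  - exact: sub_trivIset triv.
  - by apply: (measurable_int mu); apply: integrableS intn => //; exact: mA.
apply: ler_sum => i _; rewrite primitive_increment; last by have [_ []] := lr i.
by apply: le_normr_Rintegral => //; exact: integrable_on.
Qed.

Lemma primitive_derive : {ae mu, forall x : R, is_derive x 1 primitive (f x)}.
Proof.
have locf : locally_integrable setT f.
  by apply: open_integrable_locally => //; exact: openT.
have := FTC1Ny (fun y => integrable_on (measurable_itv `]-oo, y])) locf.
apply: filterS; first exact: (ae_filter_ringOfSetsType mu).
by move=> x [dx <-]; rewrite derive1E; exact: derivableP.
Qed.

End Primitive.

Lemma trivIset_ord1 (T : Type) (F : 'I_1 -> set T) : trivIset setT F.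
Proof. by move=> i j _ _ _; rewrite (ord1 i) (ord1 j). Qed.

Lemma absolutely_continuous_small_increment (R : realType) (a b : R) (f : R -> R) :
  absolutely_continuous_on a b f -> forall e, 0 < e -> exists2 d, 0 < d &
  forall x y, a <= x -> x <= y -> y <= b -> y - x < d -> `|f y - f x| < e.
Proof.
move=> acf e e0; have [d d0 hd] := acf e e0; exists d => // x y ax xy yb yxd.
have := hd 1%N (fun _ => x) (fun _ => y); rewrite !big_ord1; apply => //.
exact: trivIset_ord1.
Qed.

Lemma primitive_continuous (R : realType) (f : R -> R) :
  (@lebesgue_measure R).-integrable setT (EFin \o f) -> continuous (primitive f).
Proof.
move=> intf x; apply/cvgrPdist_lt => e e0.
have [d d0 hd] := absolutely_continuous_small_increment
  (primitive_absolutely_continuous intf (x - 1) (x + 1)) e0.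
near=> y.
have yx1 : `|y - x| < 1 by near: y; exact: near_dist.
have yxd : `|y - x| < d by near: y; exact: near_dist.
have [xy|/ltW yx] := leP x y.
  by rewrite distrC; apply: hd; move: yx1 yxd; rewrite ger0_norm ?subr_ge0//; lra.
by apply: hd; move: yx1 yxd; rewrite ler0_norm ?subr_le0//; lra.
Unshelve. all: by end_near. Qed.

Lemma lipschitz_absolutely_continuous (R : realType) (a b L : R) (f : R -> R) :
  (forall x y, a <= x <= b -> a <= y <= b -> `|f x - f y| <= L * `|x - y|) ->
  absolutely_continuous_on a b f.
Proof.
move=> hf e e0; have L1 : 0 < `|L| + 1 by rewrite ltr_wpDl.
exists (e / (`|L| + 1)); first by rewrite divr_gt0.
move=> n l r lr _; rewrite ltr_pdivlMr// => h; apply: le_lt_trans h.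
rewrite mulr_suml; apply: ler_sum => i _; have [al [lri rb]] := lr i.
apply: le_trans (hf _ _ _ _) _; rewrite ?al ?rb ?(le_trans al lri) ?(le_trans lri rb)//.
rewrite mulrC ger0_norm ?subr_ge0// ler_wpM2l ?subr_ge0//.
by have := ler_norm L; lra.
Qed.

Lemma absolutely_continuousD (R : realType) (a b : R) (f g : R -> R) :
  absolutely_continuous_on a b f -> absolutely_continuous_on a b g ->
  absolutely_continuous_on a b (fun x => f x + g x).
Proof.
move=> hf hg e e0; have e2 : 0 < e / 2 by rewrite divr_gt0.
have [d1 d10 h1] := hf _ e2; have [d2 d20 h2] := hg _ e2.
exists (Num.min d1 d2); first by rewrite lt_min d10.
move=> n l r lr triv; rewrite lt_min => /andP[s1 s2].
have := ltrD (h1 n l r lr triv s1) (h2 n l r lr triv s2).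
rewrite -big_split/= -splitr; apply: le_lt_trans; apply: ler_sum => i _.
by rewrite opprD addrACA ler_normD.
Qed.

Lemma absolutely_continuousM (R : realType) (a b A B : R) (f g : R -> R) :
  (forall x, a <= x <= b -> `|f x| <= A) -> (forall x, a <= x <= b -> `|g x| <= B) ->
  absolutely_continuous_on a b f -> absolutely_continuous_on a b g ->
  absolutely_continuous_on a b (fun x => f x * g x).
Proof.
move=> fA gB hf hg e e0.
have A1 : 0 < `|A| + 1 by rewrite ltr_wpDl.
have B1 : 0 < `|B| + 1 by rewrite ltr_wpDl.
have e1 : 0 < e / 2 / (`|B| + 1) by rewrite !divr_gt0.
have e2 : 0 < e / 2 / (`|A| + 1) by rewrite !divr_gt0.
have [d1 d10 h1] := hf _ e1; have [d2 d20 h2] := hg _ e2.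
exists (Num.min d1 d2); first by rewrite lt_min d10.
move=> n l r lr triv; rewrite lt_min => /andP[s1 s2].
have := h1 n l r lr triv s1; rewrite ltr_pdivlMr// => H1.
have := h2 n l r lr triv s2; rewrite ltr_pdivlMr// => H2.
have := ltrD H1 H2; rewrite -splitr; apply: le_lt_trans.
rewrite !mulr_suml -big_split/=; apply: ler_sum => i _.
have [al [lri rb]] := lr i.
have -> : f (r i) * g (r i) - f (l i) * g (l i) =
  (f (r i) - f (l i)) * g (r i) + (g (r i) - g (l i)) * f (l i) by ring.
apply: le_trans (ler_normD _ _) _; rewrite !normrM lerD// ler_wpM2l//.
- have := gB (r i); rewrite rb (le_trans al lri) => /(_ isT).
  by have := ler_norm B; lra.
- have := fA (l i); rewrite al (le_trans lri rb) => /(_ isT).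
  by have := ler_norm A; lra.
Qed.

Lemma is_derive_within (R : realType) (D : set R) (f : R -> R) (x d : R) :
  is_derive x 1 f d -> has_derivative_within D f x d.
Proof.
move=> /is_derive1_caratheodory[g [fg cg gd]].
apply: cvg_within_filter; rewrite -gd.
apply: (@cvg_trans _ (g z @[z --> x^'])); last exact: cvg_within_filter cg.
apply: near_eq_cvg; near=> z; rewrite fg mulfK// subr_eq0.
by near: z; exact: nbhs_dnbhs_neq.
Unshelve. all: by end_near. Qed.

(** * Reduction to continuous coefficients *)

(** Composing the coefficients with the retraction of the line onto [0, 1] makes
    them bounded on the whole line without changing the equation on [0, 1].
    Derivatives at 0 and 1 are then two-sided. *)
Definition clip (R : realType) (x : R) : R := Num.max 0 (Num.min 1 x).

Lemma clip_id (R : realType) (x : R) : 0 <= x <= 1 -> clip x = x.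
Proof. by move=> /andP[x0 x1]; rewrite /clip min_r// max_r. Qed.

Lemma clip_itv (R : realType) (x : R) : 0 <= clip x <= 1.
Proof. by rewrite /clip le_max lexx ge_max ler01 ge_min lexx. Qed.

Lemma clip_continuous (R : realType) : continuous (@clip R).
Proof.
move=> x; apply: continuous_max; first exact: cvg_cst.
by apply: continuous_min; [exact: cvg_cst|exact: cvg_id].
Qed.

(** The coefficients of the system satisfied by v and w when y = e^G v and
    y' = F y + e^(- G) w, where y solves - y'' + F' y = nu y. *)
Section LiouvilleTransform.
Context {R : realType} (F G : R -> R).
Context (cF : continuous F).
Context (dG : forall x : R, is_derive x 1 G (F x)).

Definition conductance (x : R) := expR (- (2 * G (clip x))).
Definition weight (x : R) := expR (2 * G (clip x)).
Definition well (x : R) := - (F (clip x) ^+ 2 * weight x).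

Let cG : continuous G := is_derive_continuousT dG.

Lemma comp_clip_continuous (f : R -> R) : continuous f -> continuous (f \o @clip R).
Proof. by move=> cf x; apply: continuous_comp; [exact: clip_continuous|exact: cf]. Qed.

Lemma weight_continuous : continuous weight.
Proof.
move=> x; apply: (@continuous_comp _ _ _ (fun x => 2 * G (clip x)) (@expR R)).
  by apply: cvgM; [exact: cvg_cst|exact: comp_clip_continuous].
exact: continuous_expR.
Qed.

Lemma conductance_continuous : continuous conductance.
Proof.
move=> x; apply: (@continuous_comp _ _ _ (fun x => - (2 * G (clip x))) (@expR R)).
  by apply: cvgN; apply: cvgM; [exact: cvg_cst|exact: comp_clip_continuous].
exact: continuous_expR.
Qed.

Lemma well_continuous : continuous well.
Proof.
move=> x; apply: cvgN; apply: cvgM; last exact: weight_continuous.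
by apply: cvgM; exact: comp_clip_continuous.
Qed.

Lemma clip_bounded (f : R -> R) : continuous f -> exists B, forall x, `|f (clip x)| <= B.
Proof.
move=> cf; have [B hB] := continuous_bounded_unit_itv cf.
by exists B => x; apply: hB; exact: clip_itv.
Qed.

Lemma coefficient_bounds : exists M, exists2 r0, 0 < r0 &
  [/\ forall x, `|conductance x| <= M, forall x, `|well x| <= M,
      forall x, `|weight x| <= M & forall x, r0 <= weight x].
Proof.
have [B hB] := clip_bounded cG; have [A hA] := clip_bounded cF.
have B0 : 0 <= B := le_trans (normr_ge0 _) (hB 0).
have A0 : 0 <= A := le_trans (normr_ge0 _) (hA 0).
pose E := expR (2 * B).
have E0 : 0 <= E by exact: expR_ge0.
have hw x : weight x <= E.
  by rewrite ler_expR ler_pM2l//; have := hB x; rewrite ler_norml => /andP[].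
have hc x : conductance x <= E.
  rewrite ler_expR -mulrN ler_pM2l//; have := hB x; rewrite ler_norml => /andP[]; lra.
have w0 x : 0 <= weight x by exact: expR_ge0.
exists (A ^+ 2 * E + E), (expR (- (2 * B))); first exact: expR_gt0.
split=> x.
- rewrite ger0_norm ?expR_ge0//; apply: le_trans (hc x) _.
  by rewrite lerDr mulr_ge0// sqr_ge0.
- rewrite normrN normrM (ger0_norm (w0 x)) normrX.
  apply: (@le_trans _ _ (A ^+ 2 * E)); last by rewrite lerDl.
  apply: ler_pM => //.
  by rewrite ler_pXn2r ?nnegrE.
- rewrite ger0_norm ?expR_ge0//; apply: le_trans (hw x) _.
  by rewrite lerDr mulr_ge0// sqr_ge0.
- by rewrite ler_expR -mulrN ler_pM2l//; have := hB x; rewrite ler_norml => /andP[+ _]; lra.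
Qed.

Context (nu : R) (v w : R -> R).
Context (vw : solves conductance (pot well weight nu) v w).

(** The solution y and its derivative, recovered from v and w. *)
Definition lift (x : R) := expR (G x) * v x.
Definition lift' (x : R) := F x * lift x + expR (- G x) * w x.

Let dexpG (x : R) : is_derive x 1 (fun z => expR (G z)) (expR (G x) * F x).
Proof. exact: is_derive_expR_comp. Qed.

Let dexpNG (x : R) : is_derive x 1 (fun z => expR (- G z)) (expR (- G x) * - F x).
Proof. by apply: (@is_derive_expR_comp R (fun z => - G z)); exact: is_derive_opp. Qed.

Lemma lift_derive (x : R) : 0 <= x <= 1 -> is_derive x 1 lift (lift' x).
Proof.
move=> x01; apply: (is_derive_eq (is_derive_mul (dexpG x) (vw x).1)).
rewrite /lift' /lift /conductance clip_id//.
have -> : - G x = G x + - (2 * G x) by ring.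
by rewrite expRD; ring.
Qed.

Let momentum x := expR (- G x) * w x.

Lemma momentum_derive (x : R) : 0 <= x <= 1 ->
  is_derive x 1 momentum (- F x * momentum x - (nu + F x ^+ 2) * lift x).
Proof.
move=> x01; apply: (is_derive_eq (is_derive_mul (dexpNG x) (vw x).2)).
rewrite /momentum /lift /pot /well /weight clip_id//.
have -> : expR (G x) = expR (- G x) * expR (2 * G x) by rewrite -expRD; congr expR; ring.
by ring.
Qed.

(** The terms in F^2 cancel, so that the only derivative of F left is p; this is
    the equation - y'' + p y = nu y at a point where F' = p. *)
Lemma lift'_derive (x p : R) : 0 <= x <= 1 -> is_derive x 1 F p ->
  is_derive x 1 lift' ((p - nu) * lift x).
Proof.
move=> x01 dF.
apply: (is_derive_eq
  (is_derive_add (is_derive_mul dF (lift_derive x01)) (momentum_derive x01))).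
by rewrite /lift' -/(momentum x); ring.
Qed.

Lemma absolutely_continuous_of_derive (f df : R -> R) :
  (forall x : R, 0 <= x <= 1 -> is_derive x 1 f (df x)) -> continuous df ->
  absolutely_continuous_on 0 1 f.
Proof.
move=> hf cdf; have [L hL] := continuous_bounded_unit_itv cdf.
exact: lipschitz_absolutely_continuous (derive_bound_lipschitz hf hL).
Qed.

Let cv : continuous v := (solves_continuous vw).1.
Let cw : continuous w := (solves_continuous vw).2.

Let cexpG : continuous (fun x => expR (G x)) := is_derive_continuousT dexpG.
Let cexpNG : continuous (fun x => expR (- G x)) := is_derive_continuousT dexpNG.

Let clift : continuous lift.
Proof. by move=> x; apply: cvgM; [exact: cexpG|exact: cv]. Qed.

Let cmomentum : continuous momentum.
Proof. by move=> x; apply: cvgM; [exact: cexpNG|exact: cw]. Qed.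

Lemma lift_absolutely_continuous : absolutely_continuous_on 0 1 lift.
Proof.
apply: (absolutely_continuous_of_derive lift_derive) => x.
apply: cvgD; last exact: cmomentum.
by apply: cvgM; [exact: cF|exact: clift].
Qed.

Lemma lift'_absolutely_continuous : absolutely_continuous_on 0 1 F ->
  absolutely_continuous_on 0 1 lift'.
Proof.
move=> acF; apply: absolutely_continuousD.
  have [A hA] := continuous_bounded_unit_itv cF;
    have [B hB] := continuous_bounded_unit_itv clift.
  exact: absolutely_continuousM hA hB acF lift_absolutely_continuous.
apply: (absolutely_continuous_of_derive momentum_derive) => x.
apply: cvgB; first by apply: cvgM; [apply: cvgN; exact: cF|exact: cmomentum].
apply: cvgM; last exact: clift.
by apply: cvgD; [exact: cvg_cst|apply: cvgM; exact: cF].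
Qed.

End LiouvilleTransform.

(** * Eigenvalues from the discriminant *)

(** A real matrix of determinant 1 and trace 2 cos t has the eigenvalue e^(i t).
    The eigenvector is (al, be + i ga): it is (s, e^(i t) - c) when s does not
    vanish.  When s = 0 the diagonal entries are real and inverse to each
    other with sum 2 cos t, so they are both cos t = e^(i t), and (0, 1) is an
    eigenvector. *)
Lemma monodromy_eigenvector (R : realType) (c C s S t : R) :
  c * S - C * s = 1 -> c + S = 2 * cos t ->
  exists al be ga : R, ~ (al = 0 /\ be = 0) /\
  [/\ al * c + be * s = cos t * al, ga * s = sin t * al,
      al * C + be * S = cos t * be - sin t * ga & ga * S = cos t * ga + sin t * be].
Proof.
move=> det tr; have cE : c = 2 * cos t - S by rewrite -tr addrK.
have [s0|s0] := eqVneq s 0.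
  have h : (S - cos t) ^+ 2 + sin t ^+ 2 = 0.
    have cS : c * S = 1 by rewrite -det s0 mulr0 subr0.
    by rewrite sin2cos2; move: cS; rewrite cE; lra.
  have SE : S = cos t.
    apply/eqP; rewrite -subr_eq0 -sqrf_eq0; apply/eqP.
    by have := sqr_ge0 (S - cos t); have := sqr_ge0 (sin t); lra.
  have st : sin t = 0.
    apply/eqP; rewrite -sqrf_eq0; apply/eqP.
    by have := sqr_ge0 (S - cos t); have := sqr_ge0 (sin t); lra.
  exists 0, 1, 0; split; first by case=> _ /eqP; rewrite oner_eq0.
  by split; rewrite ?s0 ?SE ?st; ring.
(* The kernel of the first row of the matrix minus e^(i t). *)
exists s, (cos t - c), (sin t); split; first by case=> /eqP; rewrite (negbTE s0).
have CE : s * C = c * S - 1 by rewrite -det; ring.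
have t2 : sin t * sin t = 1 - cos t * cos t by have := sin2cos2 t; rewrite !expr2.
split; try ring.
- by rewrite CE t2 cE; ring.
- by rewrite cE; ring.
Qed.

(** If the combination vanished on [0, 1], its second component would vanish at
    an interior point too, against the invertibility of the matrix of
    solutions. *)
Lemma combination_nonzero (R : realType) (a b : R -> R) (F : fundamental a b)
    (al be : R) : (forall x, 0 < a x) -> ~ (al = 0 /\ be = 0) ->
  exists2 x, 0 <= x <= 1 & al * fc F x + be * fs F x != 0.
Proof.
move=> a_gt0 nz; apply: contrapT => H; apply: nz.
pose v x := al * fc F x + be * fs F x; pose w x := al * fC F x + be * fS F x.
have v0 x : 0 <= x <= 1 -> v x = 0.
  by move=> x01; apply/eqP/negPn/negP => h; apply: H; exists x.
have h01 : 0 < (2^-1 : R) <= 1 by apply/andP; split; lra.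
have h01' : 0 <= (2^-1 : R) <= 1 by case/andP: h01 => /ltW -> ->.
have dv : is_derive (2^-1 : R) 1 v (a 2^-1 * w 2^-1).
  by apply: (is_derive_eq
    (is_derive_add (is_derive_scale al (fcP F _).1) (is_derive_scale be (fsP F _).1)));
    rewrite /w; ring.
have v_ge0 y : 0 <= y <= 1 -> 0 <= v y by move=> /v0 ->.
have [_] := derive_at_zero_of_nonneg dv (v0 _ h01') h01 v_ge0.
have h1 : (2^-1 : R) < 1 by lra.
move=> /(_ h1)/eqP; rewrite mulf_eq0 gt_eqF//= => /eqP w0.
have := v0 _ h01'; have := wronskian_eq1 F 2^-1; rewrite /v; rewrite /w in w0.
move: w0; move: (fc F _) (fC F _) (fs F _) (fS F _) => c C s S w0 det vv.
split.
- have -> : al = (al * c + be * s) * S - (al * C + be * S) * s.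
    by rewrite -[LHS]mulr1 -det; ring.
  by rewrite w0 vv; ring.
- have -> : be = (al * C + be * S) * c - (al * c + be * s) * C.
    by rewrite -[LHS]mulr1 -det; ring.
  by rewrite w0 vv; ring.
Qed.

Lemma solves_combination (R : realType) (a b v w v' w' : R -> R) (p q : R) :
  solves a b v w -> solves a b v' w' ->
  solves a b (fun x => p * v x + q * v' x) (fun x => p * w x + q * w' x).
Proof.
move=> h h' x; split.
- by apply: (is_derive_eq
    (is_derive_add (is_derive_scale p (h x).1) (is_derive_scale q (h' x).1))); ring.
- by apply: (is_derive_eq
    (is_derive_add (is_derive_scale p (h x).2) (is_derive_scale q (h' x).2))); ring.
Qed.

(** The real and imaginary parts of the eigenfunction are the lifts of the real
    and imaginary parts of a solution of the system with a quasi-periodic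
    eigenvector as initial value.  As G vanishes at both ends and F 0 = F 1,
    lifting preserves the boundary conditions. *)
Lemma discriminant_eigenvalue (R : realType) (q F G : R -> R) (t m nu : R)
    (Phi : fundamental (conductance G) (pot (well F G) (weight G) nu)) :
  continuous F -> (forall x : R, is_derive x 1 G (F x)) ->
  absolutely_continuous_on 0 1 F -> F 0 = F 1 -> G 0 = 0 -> G 1 = 0 ->
  {ae (@lebesgue_measure R), forall x : R, 0 <= x <= 1 ->
     is_derive x 1 F (q x - m)} ->
  fc Phi 1 + fS Phi 1 = 2 * cos t -> is_eigenvalue q t (nu + m).
Proof.
move=> cF dG acF F01 G0 G1 aeF tr.
have det := wronskian_eq1 Phi 1.
have [al [be [ga [nz [e1 e2 e3 e4]]]]] := monodromy_eigenvector det tr.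
pose vr x := al * fc Phi x + be * fs Phi x.
pose wr x := al * fC Phi x + be * fS Phi x.
pose vi x := 0 * fc Phi x + ga * fs Phi x.
pose wi x := 0 * fC Phi x + ga * fS Phi x.
have hr : solves (conductance G) (pot (well F G) (weight G) nu) vr wr.
  exact: solves_combination (fcP Phi) (fsP Phi).
have hi : solves (conductance G) (pot (well F G) (weight G) nu) vi wi.
  exact: solves_combination (fcP Phi) (fsP Phi).
exists (fun x => Complex (lift G vr x) (lift G vi x)).
exists (fun x => Complex (lift' F G vr wr x) (lift' F G vi wi x)).
split.
- split.
  + by split; apply: lift_absolutely_continuous.
  + by split; apply: lift'_absolutely_continuous.
  + move=> x /=; rewrite in_itv/= => x01.
    by split; apply: is_derive_within; exact: lift_derive.
  + move: aeF; apply: filterS;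
    first exact: (ae_filter_ringOfSetsType (@lebesgue_measure R)).
    move=> x hx /=; rewrite in_itv/= => x01; have {}hx := hx x01.
    exists (Complex ((q x - m - nu) * lift G vr x) ((q x - m - nu) * lift G vi x)).
      by split; apply: is_derive_within; exact: lift'_derive.
    by apply/eqP; rewrite eq_complex /=; apply/andP; split; apply/eqP; ring.
- split; apply/eqP; rewrite eq_complex /= /lift' /lift ?G0 ?G1 -?F01 ?oppr0 ?expR0 ?mul1r;
    rewrite /vr /vi /wr /wi ?fc0 ?fC0 ?fs0 ?fS0; apply/andP; split; apply/eqP.
  + by rewrite e1; ring.
  + by rewrite mul0r add0r e2; ring.
  + by rewrite e1 e3; ring.
  + by rewrite !mul0r !add0r e2 e4; ring.
- have cpos x : 0 < conductance G x by exact: expR_gt0.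
  have [x x01 nx] := combination_nonzero Phi cpos nz.
  exists x; first by rewrite /= in_itv.
  rewrite eq_complex/= negb_and /lift mulf_neq0//.
  by rewrite gt_eqF// expR_gt0.
Qed.

(** * Rigidity *)

(** For nu < nu0 the hypothesis reads
    int e^(2 G) F^2 <= (tau^2 - nu) int e^(2 G); in the limit the right-hand
    side is not positive. *)
Lemma primitive_eq0_of_energy (R : realType) (F G : R -> R) (tau nu0 : R) :
  continuous F -> (forall x : R, is_derive x 1 G (F x)) -> tau ^+ 2 <= nu0 ->
  (forall nu, nu < nu0 -> forall J : R -> R,
     (forall x : R, is_derive x 1 J
        (tau ^+ 2 / conductance G x + pot (well F G) (weight G) nu x)) ->
     J 0 <= J 1) ->
  forall x, 0 < x < 1 -> F x = 0.
Proof.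
move=> cF dG tau_nu H.
have cG : continuous G := is_derive_continuousT dG.
have [K1 K10 dK1] := antiderivative (weight_continuous dG).
have [K2 K20 dK2] : exists2 K2 : R -> R, K2 0 = 0 &
    forall x : R, is_derive x 1 K2 (F (clip x) ^+ 2 * weight G x).
  apply: antiderivative => x; apply: cvgM; last exact: weight_continuous.
  by apply: cvgM; exact: comp_clip_continuous.
have w0 x : 0 < weight G x by exact: expR_gt0.
have K11 : 0 <= K1 1.
  by rewrite -K10; apply: (derive_ge0_le ler01 (fun x _ => dK1 x)) => x _; exact: ltW.
have K2mono x y : x <= y -> K2 x <= K2 y.
  move=> xy; apply: (derive_ge0_le xy (fun x _ => dK2 x)) => z _.
  by rewrite mulr_ge0 ?sqr_ge0// ltW.
have key nu : nu < nu0 -> K2 1 <= (tau ^+ 2 - nu) * K1 1.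
  move=> hnu.
  have := H nu hnu (fun x => (tau ^+ 2 - nu) * K1 x - K2 x).
  rewrite K10 K20 mulr0 subr0 subr_ge0; apply => x.
  apply: (is_derive_eq (is_derive_sub (is_derive_scale _ (dK1 x)) (dK2 x))).
  by rewrite /pot /well /conductance /weight expRN invrK; ring.
have K21 : K2 1 <= 0.
  rewrite leNgt; apply/negP => K2pos.
  (* At nu0 - d the inequality key bounds K2 1 by d * K1 1, less than half of
   it. *)
  pose d := K2 1 / 2 / (K1 1 + 1).
  have K1p : 0 < K1 1 + 1 by rewrite ltr_wpDl.
  have d0 : 0 < d by rewrite !divr_gt0.
  have dE : d * (K1 1 + 1) = K2 1 / 2 by rewrite divfK// gt_eqF.
  have := key (nu0 - d); rewrite ltrBlDr ltrDl => /(_ d0).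
  have : (tau ^+ 2 - (nu0 - d)) * K1 1 <= d * K1 1 by rewrite ler_wpM2r//; lra.
  lra.
have K2_0 y : 0 <= y <= 1 -> K2 y = 0.
  move=> /andP[y0 y1]; apply/eqP; rewrite eq_le (le_trans (K2mono _ _ y1) K21)/=.
  by rewrite -K20 K2mono.
move=> x /andP[x0 x1].
have x01 : 0 <= x <= 1 by rewrite !ltW.
have K2_ge0 y : 0 <= y <= 1 -> 0 <= K2 y by move=> /K2_0 ->.
have [|_ /(_ x1)] := derive_at_zero_of_nonneg (dK2 x) (K2_0 x x01) _ K2_ge0.
  by rewrite x0 ltW.
rewrite clip_id// => /eqP; rewrite mulf_eq0 sqrf_eq0 (gt_eqF (w0 x)) orbF.
by move/eqP.
Qed.

Lemma is_derive_zero_of_locally_zero (R : realType) (f : R -> R) (a b x d : R) :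
  a < x < b -> (forall y, a < y < b -> f y = 0) -> is_derive x 1 f d -> d = 0.
Proof.
move=> /andP[ax xb] f0 [_ <-]; have h : is_derive x 1 f 0.
  apply: (near_eq_is_derive (f := cst 0)).
  near=> y; rewrite f0//; apply/andP; split; near: y; [exact: lt_nbhsr|exact: lt_nbhsl].
by case: h.
Unshelve. all: by end_near. Qed.

Lemma ae_neq (R : realType) (a : R) :
  {ae (@lebesgue_measure R), forall x : R, x != a}.
Proof.
exists [set a]; split; [exact: measurable_set1|exact: lebesgue_measure_set1|].
by move=> x /= /negP; rewrite negbK => /eqP.
Qed.

(** The boundary condition acts through cos t alone, so that any plane wave
    e^(i tau x) with cos tau = cos t may be compared with lambda0, and its
    energy is tau^2. *)
Lemma rigidity_of_plane_wave (R : realType) (q : R -> R) (t lambda0 tau : R) :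
  (@lebesgue_measure R).-integrable `[0, 1] (EFin \o q) ->
  is_first_eigenvalue q t lambda0 -> cos tau = cos t ->
  tau ^+ 2 + \int[@lebesgue_measure R]_(x in `[0, 1]) q x <= lambda0 ->
  {ae (@lebesgue_measure R), forall x : R, `[0, 1]%classic x ->
     q x = \int[@lebesgue_measure R]_(s in `[0, 1]) q s}.
Proof.
move=> hq [_ first] cos_tau; set m := Rintegral _ _ _ => hlambda.
pose I01 : set R := `[0, 1]%classic.
(* Extended by 0, so that its primitive is defined and absolutely continuous
   on the whole line. *)
pose qt : R -> R := (fun x => q x - m) \_ I01.
have intc : (@lebesgue_measure R).-integrable I01 (EFin \o cst m).
  exact: continuous_integrable_itv (@cst_continuous _ _ m).
have intqm : (@lebesgue_measure R).-integrable I01 (EFin \o (fun x => q x - m)).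
  by apply: (integrableB _ hq intc); exact: measurable_itv.
have intqt : (@lebesgue_measure R).-integrable setT (EFin \o qt).
  move: intqm; rewrite integrable_mkcond//=; last exact: measurable_itv.
  by rewrite (restrict_EFin (fun x => q x - m)).
pose F0 := primitive qt.
have cF0 : continuous F0 := primitive_continuous intqt.
have [G00 G000 dG00] := antiderivative cF0.
(* The value G00 1 is the mean of F0, so that the primitive of F vanishes at 1. *)
pose F x := F0 x - G00 1; pose G x := G00 x - G00 1 * x.
have cF : continuous F by move=> x; apply: cvgB; [exact: cF0|exact: cvg_cst].
have dG (x : R) : is_derive x 1 G (F x).
  apply: (is_derive_eq
    (is_derive_sub (dG00 x) (is_derive_scale (G00 1) (is_derive_id x (1 : R))))).
  by rewrite mulr1.
have G0 : G 0 = 0 by rewrite /G G000 mulr0 subr0.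
have G1 : G 1 = 0 by rewrite /G mulr1 subrr.
have F01 : F 0 = F 1.
  congr (_ - _); apply/esym/eqP; rewrite -subr_eq0 (primitive_increment intqt ler01).
  have -> : \int[@lebesgue_measure R]_(x in `]0, 1[) qt x =
      \int[@lebesgue_measure R]_(x in `]0, 1[) (q x - m).
    apply: eq_Rintegral => x /set_mem /=; rewrite in_itv/= => /andP[x0 x1].
    by rewrite /qt patchE mem_set// /I01 /= in_itv/= !ltW.
  rewrite Rintegral_itv_obnd_cbnd; last first.
    apply: integrableS intqm; [exact: measurable_itv|exact: measurable_itv|].
    by move=> x /=; rewrite /I01/= !in_itv/= => /andP[/ltW -> /ltW ->].
  rewrite Rintegral_itv_bndo_bndc; last first.
    apply: integrableS intqm; [exact: measurable_itv|exact: measurable_itv|].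
    by move=> x /=; rewrite /I01/= !in_itv/= => /andP[-> /ltW ->].
  have mu01 : @lebesgue_measure R `[0, 1]%classic = 1%E.
    by rewrite lebesgue_measure_itv/= lte_fin ltr01 -EFinD subr0.
  rewrite RintegralB// Rintegral_cst// -/m.
  by rewrite [X in fine X]mu01 mulr1 subrr.
have acF : absolutely_continuous_on 0 1 F.
  move=> e e0; have [d d0 hd] := primitive_absolutely_continuous intqt 0 1 e0.
  exists d => // n l r lr triv s; apply: le_lt_trans (hd n l r lr triv s).
  by apply: ler_sum => i _; rewrite /F opprB addrA subrK.
have aeF : {ae (@lebesgue_measure R), forall x : R, 0 <= x <= 1 ->
     is_derive x 1 F (q x - m)}.
  have := primitive_derive intqt; apply: filterS.
    exact: (ae_filter_ringOfSetsType (@lebesgue_measure R)).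
  move=> x hx x01; apply: (is_derive_eq
    (is_derive_sub hx (is_derive_cst (G00 1) x (1 : R)))).
  by rewrite subr0 /qt patchE mem_set// /I01 /= in_itv.
have [M [r0 r0_gt0 [cM wM gM r0_le]]] := coefficient_bounds cF dG.
have F_eq0 : forall x, 0 < x < 1 -> F x = 0.
  apply: (primitive_eq0_of_energy (tau := tau) (nu0 := lambda0 - m) cF dG); first lra.
  apply: (plane_wave_energy_below (M := M) (r0 := r0)) => //.
  - exact: conductance_continuous.
  - exact: well_continuous.
  - exact: weight_continuous.
  - by move=> x; exact: expR_gt0.
  move=> nu hnu Phi; rewrite cos_tau => tr.
  have := first _ (discriminant_eigenvalue cF dG acF F01 G0 G1 aeF tr).
  lra.
move: aeF (@ae_neq R 0) (@ae_neq R 1).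
apply: filterS3; first exact: (ae_filter_ringOfSetsType (@lebesgue_measure R)).
move=> x hx xn0 xn1 /=; rewrite in_itv/= => x01.
have x01' : 0 < x < 1.
  by move/andP: (x01) => [x0 x1]; rewrite !lt_def xn0 x0 eq_sym xn1 x1.
have := is_derive_zero_of_locally_zero x01' F_eq0 (hx x01).
by move/eqP; rewrite subr_eq0 => /eqP.
Qed.

Theorem theorem3 (R : realType) (q : R -> R) (t lambda0 : R)
  (hq : (@lebesgue_measure R).-integrable `[0, 1] (EFin \o q))
  (ht : 0 <= t < 2 * pi)
  (hlambda0 : is_first_eigenvalue q t lambda0) :
  (0 <= t < pi ->
   t ^+ 2 + \int[@lebesgue_measure R]_(x in `[0, 1]) q x <= lambda0 ->
   {ae (@lebesgue_measure R), forall x : R, `[0, 1]%classic x ->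
     q x = \int[@lebesgue_measure R]_(s in `[0, 1]) q s}) /\
  (pi <= t < 2 * pi ->
   (2 * pi - t) ^+ 2 + \int[@lebesgue_measure R]_(x in `[0, 1]) q x
     <= lambda0 ->
   {ae (@lebesgue_measure R), forall x : R, `[0, 1]%classic x ->
     q x = \int[@lebesgue_measure R]_(s in `[0, 1]) q s}).
Proof.
split=> _ h; first exact: (rigidity_of_plane_wave hq hlambda0 _ h).
apply: (rigidity_of_plane_wave hq hlambda0 _ h).
by rewrite -(cosN t) -(cosD2pi (- t)) addrC mulr_natl.
Qed.
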